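(* The algorithm AdaptiveCensoringCode (with any fixed constant $\mu>0$) is approximately asymptotically adaptive with respect to $\bigcup_{\alpha>0}\mathcal{W}_\alpha$. That is, if $(Q^n)_n$ is the sequence of coding probabilities associated with the algorithm, then for each $P\in\bigcup_{\alpha>0}\mathcal{W}_\alpha$ and each $\alpha$ such that $P\in\mathcal{W}_\alpha$, $$\frac{D(P^n,Q^n)}{R^+(\mathcal{W}_\alpha^n)}\in O(\log n).$$
   Context: Logarithms are in base 2; $\mathbb{N}_+=\{1,2,\dots\}$. A source on $\mathbb{N}_+$ is a probability distribution $P$ on $\mathbb{N}_+^{\mathbb{N}}$; $P^n$ is the law of the first $n$ symbols $X_{1:n}$; for a class $\Lambda$ of sources, $\Lambda^n=\{P^n:P\in\Lambda\}$. The minimax redundancy is $R^+(\Lambda^n)=\inf_{Q^n}\sup_{P\in\Lambda}D(P^n,Q^n)$ with $Q^n$ ranging over probability distributions on $\mathbb{N}_+^n$ and $D(P^n,Q^n)=\sum_{\mathbf{x}}P^n(\mathbf{x})\log\frac{P^n(\mathbf{x})}{Q^n(\mathbf{x})}$. For $\alpha>0$, $\Lambda_{\cdot^{-\alpha}}$ is the class of stationary memoryless (i.i.d.) sources $P$ on $\mathbb{N}_+$ with $P^1(k)\le k^{-\alpha}$ for all $k$, and $$\mathcal{W}_\alpha=\left\{P:\ P\in\Lambda_{\cdot^{-\alpha}},\ 0<\liminf_k k^\alpha P^1(k)\le\limsup_k k^\alpha P^1(k)<\infty\right\}.$$ AdaptiveCensoringCode. For $\mathbf{x}\in\mathbb{N}_+^n$,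 let $Z_n(\mathbf{x})$ be the number of distinct symbols in $\mathbf{x}$, and let $\hat K_n=\mu Z_n(\mathbf{x})$ (rounded to an integer, $\hat K_n=\max(1,\lfloor\mu Z_n(\mathbf{x})\rfloor)$), where $\mu>0$ is a fixed constant. The code of $\mathbf{x}$ consists of: (i) the Elias penultimate codeword of $\hat K_n$; (ii) $\mathtt{C1}(\mathbf{x})$, the concatenation of the Elias penultimate codewords of the symbols $\mathbf{x}_i>\hat K_n$; (iii) $\mathtt{C2}(\mathbf{x})$, the arithmetic code of the string $\mathbf{y}$ defined by $\mathbf{y}_i=\mathbf{x}_i$ if $\mathbf{x}_i\le\hat K_n$ and $\mathbf{y}_i=0$ otherwise, using the Krichevsky–Trofimov mixture over the alphabet $\{0,\dots,\hat K_n\}$, i.e. the sequential conditional probabilities $\frac{n_i^j+1/2}{i+(\hat K_n+1)/2}$ for $\mathbf{y}_{i+1}=j$, $n_i^j$ being the number of occurrences of $j$ in $\mathbf{y}_{1:i}$; its length is minus the logarithm of the resulting probability of $\mathbf{y}$, up to a quantity smaller than 1. The Elias penultimate codeword of $j\ge1$ has exactly $\ell(j)=\lfloor\log j+2\log(1+\log j)+1\rfloor$ bits. If $\hat L(\mathbf{x})$ is the total length of the code of $\mathbf{x}$, the associated coding probability is $Q^n(\mathbf{x})=2^{-\hat L(\mathbf{x})}$, so that $D(P^n,Q^n)=\mathbb{E}_P[\hat L(X_{1:n})]-H(X_{1:n})$, with $H$ the Shannon entropy. *)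

(* Defs.v *)
From HB Require Import structures.
From mathcomp Require Import all_boot all_order all_algebra.
From mathcomp Require Import all_classical all_reals all_analysis.
Set Implicit Arguments.
Unset Strict Implicit.
Unset Printing Implicit Defensive.
Import Order.TTheory GRing.Theory Num.Theory.
Import numFieldNormedType.Exports.
Local Open Scope classical_set_scope.
Local Open Scope ring_scope.

Definition npos := {k : nat | (0 < k)%N}.
HB.instance Definition _ := Countable.on npos.
Definition npos_succ (k : nat) : npos := exist _ k.+1 (ltn0Sn k).
HB.instance Definition _ := isPointed.Build npos (npos_succ 0).

(* Since npos is countable, these sets generate the product sigma-algebra of
   the discrete sigma-algebras. *)
Definition coord_sets : set (set (nat -> npos)) :=
  [set B | exists (i : nat) (a : npos), B = [set w | w i = a]].

Definition source (R : realType) :=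
  probability (g_sigma_algebraType coord_sets) R.

Definition log2 (R : realType) (x : R) : R := ln x / ln 2.

Section Sources.
Variable R : realType.
Implicit Types (P : source R) (L : set (source R)) (alpha : R).

(* law P x is P^n(x), the length n being that of the tuple x. *)
Definition law P (n : nat) (x : n.-tuple npos) : R :=
  fine (P [set w | forall i : 'I_n, w i = tnth x i]).

Definition memoryless P :=
  forall (n : nat) (x : n.-tuple npos),
    law P x = \prod_(i < n) law P [tuple tnth x i].

Definition power_envelope alpha : set (source R) :=
  [set P | memoryless P /\
    forall k : npos, law P [tuple k] <= (val k)%:R `^ (- alpha)].

Definition scaled_marginal alpha P (k : nat) : \bar R :=
  (k.+1%:R `^ alpha * law P [tuple npos_succ k])%:E.

Definition power_class alpha : set (source R) :=
  [set P | [/\ power_envelope alpha P,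
    (0 < limn_einf (scaled_marginal alpha P))%E,
    (limn_einf (scaled_marginal alpha P)
       <= limn_esup (scaled_marginal alpha P))%E
    & (limn_esup (scaled_marginal alpha P) < +oo)%E]].

(* Conventions: 0 log (0 / b) = 0, and a log (a / 0) = +oo for a > 0. *)
Definition kl_term (a b : R) : \bar R :=
  if a == 0 then 0%E else if b == 0 then +oo%E else (a * log2 (a / b))%:E.

(* The terms have no constant sign, so the sum is the sum of the positive parts
   minus that of the negative parts; the latter is at most log2 e as soon as
   the total mass of q is at most 1. *)
Definition kl (T : choiceType) (p q : T -> R) : \bar R :=
  let t := fun x : T => kl_term (p x) (q x) in
  (\esum_(x in [set: T]) t^\+ x - \esum_(x in [set: T]) t^\- x)%E.

Definition is_pmf (T : choiceType) (q : T -> R) :=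
  (forall x, 0 <= q x) /\ \esum_(x in [set: T]) (q x)%:E = 1%E.

Definition minimax_redundancy L (n : nat) : \bar R :=
  ereal_inf [set ereal_sup [set kl (@law P n) q | P in L]
    | q in [set q : n.-tuple npos -> R | is_pmf q]].

End Sources.

Section AdaptiveCensoringCode.
Variable R : realType.

Definition elias_length (j : nat) : nat :=
  Num.truncn (log2 (j%:R : R) + 2 * log2 (1 + log2 j%:R) + 1).

Definition cutoff (mu : R) (s : seq npos) : nat :=
  maxn 1 (Num.truncn (mu * (size (undup s))%:R)).

Definition censor (K : nat) (s : seq npos) : seq nat :=
  [seq if (val a <= K)%N then val a else 0%N | a <- s].

(* The alphabet is {0, ..., K}, of size K + 1. *)
Definition kt_prob (K : nat) (y : seq nat) : R :=
  \prod_(i < size y)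
    (((count_mem (nth 0%N y i) (take i y))%:R + 1 / 2)
       / (i%:R + K.+1%:R / 2)).

(* arith K y is the number of bits of the arithmetic code of the string y over
   {0, ..., K}; it is only known up to an error smaller than one bit. *)
Definition kt_arithmetic_length (arith : nat -> seq nat -> nat) :=
  forall (K : nat) (y : seq nat), (0 < K)%N -> all (fun a => (a <= K)%N) y ->
    `|(arith K y)%:R - (- log2 (kt_prob K y))| < 1.

Definition ac_length (arith : nat -> seq nat -> nat) (mu : R)
    (s : seq npos) : nat :=
  let K := cutoff mu s in
  (elias_length K
   + \sum_(a <- s | (K < val a)%N) elias_length (val a)
   + arith K (censor K s))%N.

Definition ac_coding_prob (arith : nat -> seq nat -> nat) (mu : R)
    (n : nat) (x : n.-tuple npos) : R :=
  2 ^- ac_length arith mu x.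

End AdaptiveCensoringCode.

(* Main.v *)
From HB Require Import structures.
Require Import Defs.
From mathcomp Require Import all_boot all_order all_algebra.
From mathcomp Require Import all_classical all_reals all_analysis.
From mathcomp Require Import ring lra zify.
Import Order.TTheory GRing.Theory Num.Theory.
Import numFieldNormedType.Exports.
Local Open Scope classical_set_scope.
Local Open Scope ring_scope.

Set Implicit Arguments.
Unset Strict Implicit.
Unset Printing Implicit Defensive.

(** Write [p] for the marginal of [P] and [y = n^(1/alpha)].  Both the
    redundancy of the code and the minimax redundancy are compared with [y]:
    the first is [O(y log n)], the second is at least [kappa * y], and the
    quotient is therefore [O(log n)].  The existence of [P] forces
    [1 < alpha], since [p k >= c * k^(-alpha)] for all large [k].

    _Minimax lower bound_ ([minimax_redundancy_ge], [minimax_growth]).  Fix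
    [m] close to [y].  For every [theta] in [{0,1}^m] recode the symbols of
    [P] one by one: of the pair [2(m+i)], [2(m+i)+1] the even symbol is sent to
    1 and the odd one to [2(m+i) + theta_i]; the other symbols do not move.  The
    envelope allows mass 1 on the symbol 1, so it still holds, and the tail is
    unchanged, so the recoded source stays in the class.  One bit [theta_i] is
    revealed exactly when the [i]-th pair is seen, so the mutual information
    between a uniform [theta] and the sample, which bounds the minimax
    redundancy from below, is the expected number of pairs seen.  Each pair
    has probability of order [1/n], hence is seen with probability bounded
    below, and the expected number is of order [m].  Obtaining the sources by
    recoding [P] itself avoids constructing any infinite product measure.

    _Upper bound for the code_ ([kl_ac_coding_le], [kl_growth]).  Let [K] be
    the cutoff.  The Krichevsky-Trofimov probability of the censored string is at
    least its likelihood under the censored marginal, up to a factor whose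
    logarithm is at most [2 (K+1) log (n+K+1)] ([kt_prob_lower]); a censored
    symbol moreover costs its Elias codeword.  Hence [log (P^n / Q^n)] is
    pointwise at most a constant plus the Elias length of [K], the Elias
    lengths of the symbols above [K], and that logarithm.  In expectation
    [K = O(y)], because the number of distinct symbols is at most about [y] plus
    the number of symbols larger than [y]; and the symbols above a fixed fraction
    [b] of [y] have total Elias length [O(y log n)].  It remains that [K] may fall
    below [b]; this requires that half of the [h] symbols following [h], with
    [h] of order [y], be missing, and a union bound over the set of the
    missing ones makes it exponentially unlikely in [h]
    ([total_few_symbols]).

    _Lower bound for the code_ ([kl_ac_coding_ge]).  The divergence is bounded
    below because the code satisfies a Kraft inequality up to a constant
    ([kraft_ac_coding]).

    _Finiteness of the minimax redundancy_ ([minimax_redundancy_lty]).  The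
    i.i.d. coding distribution with marginal [1/(k(k+1))] has a divergence that
    the envelope bounds uniformly over the class. *)

(** * Sums over countable types *)

Definition total (R : realType) (T : choiceType) (f : T -> R) : \bar R :=
  \esum_(x in [set: T]) (f x)%:E.

Section Total.
Variables (R : realType) (T : choiceType).
Implicit Types f g : T -> R.

Lemma total_ge0 f : (forall x, 0 <= f x) -> (0 <= total f)%E.
Proof. by move=> f0; apply: esum_ge0 => x _; rewrite lee_fin. Qed.

Lemma le_total f g : (forall x, f x <= g x) -> (total f <= total g)%E.
Proof. by move=> fg; apply: le_esum => x _; rewrite lee_fin. Qed.

Lemma eq_total f g : f =1 g -> total f = total g.
Proof. by move=> fg; apply: eq_esum => x _; rewrite fg. Qed.

Lemma totalD f g : (forall x, 0 <= f x) -> (forall x, 0 <= g x) ->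
  total (fun x => f x + g x) = (total f + total g)%E.
Proof. by move=> f0 g0; rewrite -esumD// => x _; rewrite lee_fin. Qed.

Lemma total_sum (I : choiceType) (r : seq I) (f : I -> T -> R) :
  (forall i x, 0 <= f i x) ->
  total (fun x => \sum_(i <- r) f i x) = (\sum_(i <- r) total (f i))%E.
Proof.
move=> f0; rewrite /total -esum_sum; last by move=> x i _ _; rewrite lee_fin.
by apply: eq_esum => x _; rewrite sumEFin.
Qed.

Lemma sum_le_total (s : seq T) f : uniq s -> (forall x, 0 <= f x) ->
  ((\sum_(x <- s) f x)%:E <= total f)%E.
Proof.
move=> us f0; apply: esum_ge; exists [set` s] => //.
by rewrite -fsbig_seq// sumEFin.
Qed.

Lemma total_le (f : T -> R) (c : \bar R) :
  (forall s : seq T, uniq s -> ((\sum_(x <- s) f x)%:E <= c)%E) ->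
  (total f <= c)%E.
Proof.
move=> H; apply: ge_ereal_sup => _ [X [finX _]] <-.
by rewrite fsbig_finite//= sumEFin; apply: H.
Qed.

Lemma totalZ (c : R) f : 0 <= c ->
  total (fun x => c * f x) = (c%:E * total f)%E.
Proof.
move=> c0; rewrite /total /esum -ereal_supZl//; last first.
  by apply/set0P; exists 0%E; exists set0; rewrite ?fsbig_set0//; exact: fsets_set0.
congr ereal_sup; rewrite image_comp; apply: eq_imagel => X [finX _] /=.
by rewrite !fsbig_finite//= !sumEFin -EFinM mulr_sumr.
Qed.

Lemma total_le_fin f (c : R) : (forall x, 0 <= f x) -> (total f <= c%:E)%E ->
  exists2 d, total f = d%:E & 0 <= d <= c.
Proof.
move=> f0 fc; exists (fine (total f)).
  by rewrite fineK// ge0_fin_numE ?total_ge0// (le_lt_trans fc)// ltry.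
have h : total f \is a fin_num.
  by rewrite ge0_fin_numE ?total_ge0// (le_lt_trans fc)// ltry.
by rewrite -!lee_fin fineK// total_ge0.
Qed.

End Total.

(** Summing over the last symbol first is what both inductions on the sample
    size below require: products of marginals, and the sequential
    conditional probabilities of the code. *)
Lemma total_rcons (R : realType) (T : choiceType) n (f : n.+1.-tuple T -> R) :
  (forall x, 0 <= f x) ->
  total f = \esum_(t in [set: n.-tuple T])
     total (fun a => f [tuple of rcons t a]).
Proof.
move=> f0; rewrite esum_esum; last by move=> *; rewrite lee_fin.
rewrite /total (@reindex_esum _ (n.-tuple T * T)%type _
   ([set: n.-tuple T] `*`` (fun=> [set: T])) _
   (fun k => [tuple of rcons k.1 k.2])); first by apply: eq_esum.
split => //.
  move=> [t a] [u b] _ _ /= /(congr1 val)/= /rcons_inj [tu ->].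
  by congr (_, _); exact: val_inj.
move=> x _ /=; case/lastP E: (val x) => [|s a].
  by have := size_tuple x; rewrite E.
have ss : size s == n.
  by have := size_tuple x; rewrite E size_rcons => -[->].
exists (Tuple ss, a) => //; exact: val_inj.
Qed.

Lemma total_tuple0 (R : realType) (T : choiceType) (f : 0.-tuple T -> R) :
  (forall x, 0 <= f x) -> total f = (f [tuple])%:E.
Proof.
move=> f0; rewrite -[RHS](@esum_set1 R _ [tuple] (fun x => (f x)%:E)) ?lee_fin//.
congr esum; apply/seteqP; split => // x _ /=; exact: tuple0.
Qed.

(** The factors may differ from one position to the next; this is used to insert
    a function of a single coordinate, and for recoded sources. *)
Lemma total_prod (R : realType) (T : choiceType) n (F : nat -> T -> R)
    (c : nat -> R) : (forall i a, 0 <= F i a) ->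
  (forall i, (i < n)%N -> total (F i) = (c i)%:E) ->
  total (fun x : n.-tuple T => \prod_(i < n) F i (tnth x i)) =
  (\prod_(i < n) c i)%:E.
Proof.
move=> F0; elim: n => [|n IH] Fc.
  by rewrite total_tuple0 ?big_ord0// => x; rewrite big_ord0.
have cn : 0 <= c n by rewrite -lee_fin -Fc// total_ge0.
rewrite total_rcons; last by move=> x; apply: prodr_ge0.
rewrite (eq_esum (b := fun t : n.-tuple T =>
   (c n * \prod_(i < n) F i (tnth t i))%:E)); last first.
  move=> t _; rewrite mulrC EFinM -(Fc n)// -totalZ; last exact: prodr_ge0.
  apply: eq_total => a; rewrite big_ord_recr/=; congr (_ * _).
    apply: eq_bigr => i _; congr (F _ _).
    by rewrite !(tnth_nth a)/= nth_rcons size_tuple ltn_ord.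
  by rewrite (tnth_nth a)/= nth_rcons size_tuple ltnn eqxx.
rewrite -/(total _) totalZ// IH; last by move=> i /ltnW; exact: Fc.
by rewrite big_ord_recr/= mulrC EFinM.
Qed.

(** * Expectations under a product distribution *)

Definition iid (R : realType) (T : Type) (p : T -> R) n (x : n.-tuple T) : R :=
  \prod_(i < n) p (tnth x i).

Section Iid.
Variables (R : realType) (T : choiceType) (p : T -> R).
Hypothesis p_ge0 : forall a, 0 <= p a.
Implicit Types h : T -> R.

Lemma iid_ge0 n (x : n.-tuple T) : 0 <= iid p x.
Proof. exact: prodr_ge0. Qed.

Lemma total_iid_prod n h c : (forall a, 0 <= h a) ->
  total (fun a => p a * h a) = c%:E ->
  total (fun x : n.-tuple T => iid p x * \prod_(i < n) h (tnth x i)) =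
  (c ^+ n)%:E.
Proof.
move=> h0 hc; under eq_total do rewrite -big_split/=.
rewrite (@total_prod _ _ _ (fun=> fun a => p a * h a) (fun=> c))//.
  by rewrite prodr_const card_ord.
by move=> _ a; rewrite mulr_ge0.
Qed.

Hypothesis p_total : total p = 1%E.

Lemma total_iid n : total (@iid R T p n) = 1%E.
Proof.
by rewrite (@total_prod _ _ _ (fun=> p) (fun=> 1))// prodr_const expr1n.
Qed.

Lemma total_iid_sum n h c : (forall a, 0 <= h a) ->
  total (fun a => p a * h a) = c%:E ->
  total (fun x : n.-tuple T => iid p x * \sum_(i < n) h (tnth x i)) =
  (n%:R * c)%:E.
Proof.
move=> h0 hc; under eq_total do rewrite mulr_sumr.
rewrite total_sum => [|i x]; last by rewrite mulr_ge0 ?iid_ge0.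
transitivity (\sum_(i <- index_enum 'I_n) c%:E)%E; last first.
  by rewrite sumEFin sumr_const card_ord mulr_natl.
(* only the i-th factor carries h *)
apply: eq_bigr => i _; pose F k a := p a * (if k == i :> nat then h a else 1).
have -> : c = \prod_(k < n) (if k == i :> nat then c else 1).
  by rewrite (bigD1 i)//= eqxx big1 ?mulr1// => j; rewrite -val_eqE => /negbTE ->.
rewrite -(@total_prod _ _ n F (fun k => if k == i :> nat then c else 1)); last 2 first.
- by move=> k a; rewrite mulr_ge0//; case: ifP.
- move=> k _; rewrite /F; case: ifP => // _.
  by under eq_total do rewrite mulr1.
apply: eq_total => x; rewrite /F big_split/=; congr (_ * _).
by rewrite (bigD1 i)//= eqxx big1 ?mulr1// => j; rewrite -val_eqE => /negbTE ->.
Qed.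

End Iid.

(** * Tails of sums over the positive integers *)

Lemma npos_succK (a : npos) : npos_succ (val a).-1 = a.
Proof. by apply: val_inj; rewrite /= prednK// (valP a). Qed.

Lemma npos_succ_inj : injective npos_succ.
Proof. by move=> i j /(congr1 val) [->]. Qed.

Section Npos.
Variable R : realType.
Implicit Types f : npos -> R.

Lemma total_npos_le f c : (forall a, 0 <= f a) ->
  (forall N, \sum_(0 <= k < N) f (npos_succ k) <= c) -> (total f <= c%:E)%E.
Proof.
move=> f0 fc; apply: total_le => s us; rewrite lee_fin.
set N := (\max_(a <- s) val a)%N.
rewrite (le_trans _ (fc N))// -(big_map npos_succ xpredT f).
set r := map _ _; have ur : uniq r.
  by rewrite map_inj_uniq ?iota_uniq//; exact: npos_succ_inj.
have rs : perm_eq [seq a <- r | a \in s] s.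
  apply: uniq_perm => //; first exact: filter_uniq.
  move=> a; rewrite mem_filter; case: (boolP (a \in s)) => //= sa.
  apply/mapP; exists (val a).-1; last by rewrite npos_succK.
  rewrite mem_index_iota leq0n/= prednK ?(valP a)//.
  exact: (@leq_bigmax_seq _ _ xpredT (fun b : npos => val b)).
rewrite [leRHS](bigID (mem s))/= -[in leRHS]big_filter (perm_big _ rs)/=.
by rewrite lerDl sumr_ge0.
Qed.

(** Every numerical tail below is bounded by exhibiting a potential [V] whose
    decrements dominate the terms. *)
Lemma sum_telescope_le (f V : nat -> R) b N : (forall k, 0 <= V k) ->
  (forall k, (b <= k)%N -> f k <= V k - V k.+1) ->
  \sum_(0 <= k < N | (b <= k)%N) f k <= V b.
Proof.
move=> V0 fV; have [bN|Nb] := leqP b N; last first.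
  rewrite big_nat_cond big1 ?V0// => k /andP[/andP[_ kN] bk].
  by have := leq_trans Nb bk; rewrite ltnNge ltnW.
rewrite (big_cat_nat _ bN)//= big_nat_cond big1 ?add0r; last first.
  by move=> k /andP[/andP[_ kb] bk]; have := leq_ltn_trans bk kb; rewrite ltnn.
rewrite (@le_trans _ _ (\sum_(b <= k < N) (V k - V k.+1)))//.
  rewrite big_nat_cond [leRHS]big_nat_cond.
  rewrite (eq_bigl (fun k => (b <= k < N)%N && true)); last first.
    by move=> k; case: (b <= k)%N => //=; rewrite andbF.
  by apply: ler_sum => k /andP[/andP[bk _] _]; exact: fV.
under eq_bigr do rewrite -opprB.
by rewrite sumrN telescope_sumr// opprB lerBlDr lerDl.
Qed.

(** The symbol of index [k] is [k+1], so the symbols larger than [b] are those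
    of index at least [b]. *)
Lemma tail_total_le f (V : nat -> R) b : (forall a, 0 <= f a) ->
  (forall k, 0 <= V k) ->
  (forall k, (b <= k)%N -> f (npos_succ k) <= V k - V k.+1) ->
  (total (fun a => (b < val a)%:R * f a)%R <= (V b)%:E)%E.
Proof.
move=> f0 V0 fV; apply: total_npos_le => [a|N]; first by rewrite mulr_ge0.
rewrite (le_trans _ (sum_telescope_le N V0 fV))// big_mkcond/= [leRHS]big_mkcond/=.
by apply: ler_sum => k _; rewrite ltnS; case: ifP; rewrite ?mul1r ?mul0r.
Qed.

(** Discrete form of the comparison with the integral of [x^(-1-g)]:
    [(1 - 1/(k+1))^(-g)] is the exponential of [- g ln (1 - 1/(k+1))], which is
    at least [g / (k+1)]. *)
Lemma powR_tail_step (g : R) (k : nat) : 0 < g -> (0 < k)%N ->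
  k.+1%:R `^ (- (1 + g)) <= (k%:R `^ (- g) / g) - (k.+1%:R `^ (- g) / g).
Proof.
move=> g0 k0; have kR : (0 : R) < k%:R by rewrite ltr0n.
have k1R : (0 : R) < k.+1%:R by rewrite ltr0n.
rewrite -mulrBl ler_pdivlMr// lerBrDr opprD powRD; last by rewrite (gt_eqF k1R) implybT.
rewrite powR_inv1 ?ler0n//.
have -> : k%:R `^ (- g) = k.+1%:R `^ (- g) * (k%:R / k.+1%:R) `^ (- g) :> R.
  by rewrite -powRM ?divr_ge0 ?ler0n// mulrCA divff ?mulr1 ?gt_eqF.
have -> : k.+1%:R^-1 * k.+1%:R `^ (- g) * g + k.+1%:R `^ (- g) =
   k.+1%:R `^ (- g) * (1 + g * k.+1%:R^-1) :> R by ring.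
rewrite ler_pM2l ?powR_gt0// /powR gt_eqF ?divr_gt0//.
apply: le_trans (expR_ge1Dx _); rewrite lerD2l mulNr -mulrN ler_pM2l//.
rewrite lerNr (le_trans (y := ln (1 + (- k.+1%:R^-1))))//.
  rewrite ler_ln ?posrE ?divr_gt0//; last first.
    by rewrite subr_gt0 invf_lt1// ltr1n ltnS.
  rewrite le_eqVlt; apply/orP; left; apply/eqP; field => //; rewrite ?gt_eqF//.
by apply: le_ln1Dx; rewrite ltrN2 invf_lt1// ltr1n ltnS.
Qed.

Lemma powR_tail_le (g : R) (b : nat) : 0 < g -> (0 < b)%N ->
  (total (fun a : npos => (b < val a)%:R * (val a)%:R `^ (- (1 + g)))%R
    <= (b%:R `^ (- g) / g)%:E)%E.
Proof.
move=> g0 b0; apply: (tail_total_le (V := fun k => k%:R `^ (- g) / g)) => [a|k|k bk].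
- exact: powR_ge0.
- by rewrite divr_ge0 ?powR_ge0// ltW.
- by apply: powR_tail_step => //; exact: leq_trans bk.
Qed.

End Npos.

(** * Bounding a divergence from both sides *)

Section KL.
Variable R : realType.

Lemma ln2_gt0 : 0 < ln 2 :> R. Proof. by rewrite ln_gt0// ltr1n. Qed.

(** [ln u <= u - 1] at [u = c b / a]; the free factor [c] is an a priori guess
    of [a / b], and the loss [a - c b] sums to a nonnegative quantity when [c]
    is chosen well. *)
Lemma kl_term_ge (a b c : R) : 0 <= a -> 0 <= b -> 0 < c ->
  ((a * log2 c + a / ln 2 - c * b / ln 2)%:E <= kl_term a b)%E.
Proof.
move=> a0 b0 c0; have l2 := ln2_gt0; rewrite /kl_term.
have [->|an0] := eqVneq a 0.
  by rewrite !mul0r !add0r lee_fin oppr_le0 !mulr_ge0// ?invr_ge0 ltW.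
have [//|bn0] := eqVneq b 0; first by rewrite leey.
rewrite lee_fin /log2.
have a1 : 0 < a by rewrite lt_def an0.
have b1 : 0 < b by rewrite lt_def bn0.
have -> : a * (ln c / ln 2) + a / ln 2 - c * b / ln 2 =
  (a * (ln c + (1 - c * b / a))) / ln 2 by field; rewrite !gt_eqF.
rewrite mulrA ler_pM2r ?invr_gt0// ler_pM2l//.
have -> : a / b = c * (c * b / a)^-1 by field; rewrite !gt_eqF.
rewrite lnM ?posrE ?invr_gt0 ?divr_gt0 ?mulr_gt0// lnV ?posrE ?divr_gt0 ?mulr_gt0//.
rewrite lerD2l lerBlDr -lerBlDl opprK.
set u := _ / _; have u0 : 0 < u by rewrite divr_gt0 ?mulr_gt0.
by rewrite addrC -lerBrDr -[in ln u](subrK 1 u) addrC le_ln1Dx// ltrBrDr addNr.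
Qed.

Variable T : choiceType.
Implicit Types p q : T -> R.

(** Since the divergence is a difference of two sums, a lower bound must first
    make the negative part summable; [d] plays that role. *)
Lemma kl_ge p q (c d : T -> R) D :
  (forall x, 0 <= c x) -> (forall x, 0 <= d x) -> total d = D%:E ->
  (forall x, (c x - d x)%:E <= kl_term (p x) (q x))%E ->
  (total c - D%:E <= kl p q)%E.
Proof.
move=> c0 d0 dD H; rewrite /kl; pose t x := kl_term (p x) (q x); rewrite -/t.
have tn x : (t^\- x <= (d x)%:E)%E.
  rewrite funenegE ge_max lee_fin d0 andbT leeNl -EFinN.
  by apply: (le_trans _ (H x)); rewrite lee_fin lerDr.
have tD : (\esum_(x in [set: T]) t^\- x <= D%:E)%E.
  by rewrite -dD; apply: le_esum => x _.
have t0 : (0 <= \esum_(x in [set: T]) t^\- x)%E by apply: esum_ge0.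
have tf : (\esum_(x in [set: T]) t^\- x)%E \is a fin_num.
  by rewrite ge0_fin_numE// (le_lt_trans tD)// ltry.
rewrite leeBlDr// addeAC leeBrDr//.
rewrite -dD -!esumD//; try by move=> x _; rewrite lee_fin.
apply: le_esum => x _; have := H x; rewrite funeposE funenegE -/(t x).
have := c0 x; have := d0 x.
case: (t x) => [r| |] d1 c1 //=.
- rewrite -!EFin_max -!EFinD !lee_fin => h.
  by case: (leP r 0) => r0; case: (leP (- r) 0) => r1; lra.
- by move=> _; rewrite maxye addye// leey.
Qed.

Lemma kl_le p q (u : T -> R) : (forall x, 0 <= u x) ->
  (forall x, kl_term (p x) (q x) <= (u x)%:E)%E -> (kl p q <= total u)%E.
Proof.
move=> u0 H; rewrite /kl; pose t x := kl_term (p x) (q x); rewrite -/t.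
apply: (@le_trans _ _ (\esum_(x in [set: T]) t^\+ x))%E.
  by rewrite -[leRHS]sube0 leeB// esum_ge0.
by apply: le_esum => x _; rewrite funeposE ge_max H lee_fin u0.
Qed.

End KL.

(** * Cylinders, marginals and recodings of a source *)

Section Source.
Variable R : realType.
Implicit Types P : source R.

Definition cylinder n (x : n.-tuple npos) : set (g_sigma_algebraType coord_sets) :=
  [set w | forall i : 'I_n, w i = tnth x i].

Lemma measurable_coord (i : nat) (a : npos) :
  measurable ([set w | w i = a] : set (g_sigma_algebraType coord_sets)).
Proof. by apply: sub_sigma_algebra; exists i, a. Qed.

Lemma measurable_cylinder n (x : n.-tuple npos) : measurable (cylinder x).
Proof.
have -> : cylinder x =
    \bigcap_k [set w | forall i : 'I_n, i = k :> nat -> w k = tnth x i].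
  apply/seteqP; split => [w wx k _ i <-|w wx i]; first exact: wx.
  exact: (wx i).
apply: bigcapT_measurable => k; have [kn|nk] := ltnP k n; last first.
  rewrite (_ : mkset _ = setT)//; apply/seteqP; split => // w _ i ik.
  by have := ltn_ord i; rewrite ik ltnNge nk.
rewrite (_ : mkset _ = [set w | w k = tnth x (Ordinal kn)]).
  exact: measurable_coord.
apply/seteqP; split => [w /(_ (Ordinal kn) erefl)//|w wk i ik].
by rewrite [LHS]wk; congr tnth; exact: val_inj.
Qed.

Lemma lawE P n (x : n.-tuple npos) : (law P x)%:E = P (cylinder x).
Proof. by rewrite fineK// fin_num_measure//; exact: measurable_cylinder. Qed.

Lemma law_ge0 P n (x : n.-tuple npos) : 0 <= law P x.
Proof. exact: fine_ge0. Qed.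

Lemma law_le1 P n (x : n.-tuple npos) : law P x <= 1.
Proof. by rewrite -lee_fin lawE probability_le1//; exact: measurable_cylinder. Qed.

(** Countable additivity over the cylinders, which are enumerated by [pickle]. *)
Lemma prob_tuples P n (A : set (n.-tuple npos)) :
  P [set w | A [tuple w i | i < n]] = \esum_(x in A) (law P x)%:E.
Proof.
pose F k : set (g_sigma_algebraType coord_sets) :=
  [set w | exists x, [/\ A x, pickle x = k & cylinder x w]].
have FE x : A x -> F (pickle x) = cylinder x.
  move=> Ax; apply/seteqP; split => [w [y [_ /(pcan_inj pickleK) ->]]//|w wx].
  by exists x.
have F0 k : ~ (pickle @` A) k -> F k = set0.
  by move=> Ak; apply/seteqP; split => // w [x [Ax xk _]]; apply: Ak; exists x.
have mF k : measurable (F k).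
  have [[x Ax <-]|/F0 ->//] := pselect ((pickle @` A) k).
  by rewrite FE//; exact: measurable_cylinder.
have tF : trivIset setT F.
  apply/trivIsetP => j k _ _ jk; apply/seteqP; split => // w [].
  move=> [x [_ xj wx]] [y [_ yk wy]]; move/negP: jk; apply; apply/eqP.
  rewrite -xj -yk; congr pickle; apply: eq_from_tnth => i.
  by rewrite -wx -wy.
transitivity (P (\bigcup_k F k)).
  congr (P _); apply/seteqP; split => [w Aw|w [k _ [x [Ax _ wx]]]/=].
    exists (pickle [tuple w i | i < n]) => //.
    by exists [tuple w i | i < n]; split => // i; rewrite tnth_mktuple.
  suff -> : [tuple w i | i < n] = x by [].
  by apply: eq_from_tnth => i; rewrite tnth_mktuple.
rewrite measure_semi_bigcup//; last exact: bigcupT_measurable.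
rewrite nneseries_esumT//.
transitivity (\esum_(k in pickle @` A) P (F k)).
  rewrite [RHS]esum_mkcond; apply: eq_esum => k _.
  by case: ifPn => // /negP; rewrite in_setE => /F0 ->; rewrite measure0.
rewrite esum_image; last by move=> x y _ _; exact: (pcan_inj pickleK).
by apply: eq_esum => x Ax; rewrite FE// lawE.
Qed.

Definition marginal P (a : npos) : R := law P [tuple a].

Lemma total_marginal P : total (marginal P) = 1%E.
Proof.
transitivity (P [set w | [set: 1.-tuple npos] [tuple w i | i < 1]]); last first.
  by rewrite -[RHS](@probability_setT _ _ _ P); congr (P _); apply/seteqP; split.
rewrite prob_tuples (@reindex_esum _ npos _ setT _ (fun a => [tuple a]))//.
split => //; first by move=> a b _ _ /(congr1 val)[].
move=> x _; exists (thead x) => //.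
by apply: eq_from_tnth => i; rewrite !ord1.
Qed.


Lemma law_memoryless P n (x : n.-tuple npos) :
  memoryless P -> law P x = iid (marginal P) x.
Proof. by move=> mP; rewrite mP. Qed.

Section Recode.
Variable g : npos -> npos.

Definition recode_seq (w : g_sigma_algebraType coord_sets) :
  g_sigma_algebraType coord_sets := fun i => g (w i).

Lemma measurable_recode_seq : measurable_fun setT recode_seq.
Proof.
have H := @measurability _ _ _ (g_sigma_algebraType coord_sets) setT recode_seq coord_sets.
apply: H => // _ [_ [i [a ->]] <-].
rewrite setTI (_ : _ @^-1` _ = \bigcup_b [set w | g b = a /\ w i = b]).
  apply: countable_bigcupT_measurable => // b.
  have [gb|gb] := pselect (g b = a); last first.
    rewrite (_ : mkset _ = set0)//.
    by apply/seteqP; split => // w [].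
  rewrite (_ : mkset _ = [set w | w i = b]); first exact: measurable_coord.
  by apply/seteqP; split => // w [].
by apply/seteqP; split => [w /= wa|w [b _ [/= <- <-]]]//; exists (w i).
Qed.

HB.instance Definition _ := isMeasurableFun.Build _ _ _ _ recode_seq
  measurable_recode_seq.

Definition recode P : source R := distribution P recode_seq.

(** The law of [g X] when [X] has law [p]. *)
Definition recode_pmf (p : npos -> R) (a : npos) : R :=
  fine (total (fun b => (g b == a)%:R * p b)).

Lemma recode_pmfE P a :
  total (fun b => (g b == a)%:R * marginal P b) = (recode_pmf (marginal P) a)%:E.
Proof.
rewrite /recode_pmf; have [||d -> _ //] := @total_le_fin _ _ (fun b => (g b == a)%:R * marginal P b) 1.
- by move=> b; rewrite mulr_ge0// law_ge0.
- rewrite -(total_marginal P); apply: le_total => b.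
  by rewrite ler_piMl ?law_ge0// lern1 leq_b1.
Qed.

(** Recoding acts on each coordinate separately, so a memoryless source stays
    memoryless. *)
Lemma law_recode P n (x : n.-tuple npos) : memoryless P ->
  law (recode P) x = iid (recode_pmf (marginal P)) x.
Proof.
move=> mP; apply: EFin_inj; rewrite lawE.
transitivity (P [set w | [set y : n.-tuple npos | forall i, g (tnth y i) = tnth x i]
                   [tuple w i | i < n]]).
  congr (P _); apply/seteqP.
  by split => w /= wx i; have := wx i; rewrite tnth_mktuple.
rewrite prob_tuples esum_mkcond.
transitivity (total (fun y : n.-tuple npos => \prod_(i < n)
    ((g (tnth y i) == nth (npos_succ 0) x i)%:R * marginal P (tnth y i)))).
  apply: eq_esum => y _; case: ifPn => [/set_mem gy|/negP gy].
    rewrite law_memoryless//; congr EFin; apply: eq_bigr => i _.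
    by rewrite -(tnth_nth _ x i) gy eqxx mul1r.
  have [i gi] : exists i, g (tnth y i) != tnth x i.
    apply/not_existsP => h; apply: gy; apply/mem_set => i /=.
    by have /negP/negPn/eqP := h i.
  rewrite (bigD1 i)//= -(tnth_nth _ x i) (negbTE gi) !mul0r//.
rewrite (@total_prod _ _ _ (fun i b => (g b == nth (npos_succ 0) x i)%:R * marginal P b)
   (fun i => recode_pmf (marginal P) (nth (npos_succ 0) x i))).
- by congr EFin; apply: eq_bigr => i _; rewrite (tnth_nth (npos_succ 0)).
- by move=> i b; rewrite mulr_ge0// law_ge0.
- by move=> i _; exact: recode_pmfE.
Qed.
End Recode.

End Source.

(** * Consequences of membership in the power class *)

Section PowerClass.
Variable R : realType.
Implicit Types (P : source R) (alpha : R).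

Lemma limn_esup_eq (u v : (\bar R)^nat) N :
  (forall k, (N <= k)%N -> u k = v k) -> limn_esup u = limn_esup v.
Proof.
move=> uv; rewrite !limn_esup_lim; apply: (@cvg_lim _) => //.
apply: cvg_trans; last exact: is_cvg_esups.
apply: near_eq_cvg; near=> n.
rewrite /esups; congr ereal_sup; apply: eq_imagel => k /= nk.
rewrite uv//; apply: leq_trans nk; near: n; exact: nbhs_infty_ge.
Unshelve. all: by end_near. Qed.

Lemma limn_einf_eq (u v : (\bar R)^nat) N :
  (forall k, (N <= k)%N -> u k = v k) -> limn_einf u = limn_einf v.
Proof.
by move=> uv; congr oppe; apply: (limn_esup_eq (N := N)) => k /uv ->.
Qed.

Lemma power_class_lower alpha P : power_class alpha P ->
  exists2 c, 0 < c & exists k0, forall k, (k0 <= k)%N ->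
    c * k.+1%:R `^ (- alpha) <= marginal P (npos_succ k).
Proof.
move=> [_ inf0 _ _]; set u := scaled_marginal alpha P in inf0.
have [k0 e0] : exists k, (0 < einfs u k)%E.
  apply/not_existsP => h; move: inf0; rewrite limn_einf_lim ltNge => /negP; apply.
  apply: lime_le; first exact: is_cvg_einfs.
  by apply: nearW => k; rewrite leNgt; apply/negP; exact: h.
have eu k : (k0 <= k)%N -> (einfs u k0 <= u k)%E.
  by move=> k0k; apply: ereal_inf_lbound; exists k.
have ef : einfs u k0 \is a fin_num.
  by rewrite gt0_fin_numE// (le_lt_trans (eu k0 _))// ltry.
exists (fine (einfs u k0)); first by rewrite fine_gt0// e0 ltey_eq ef.
exists k0 => k /eu; rewrite -lee_fin => h.
rewrite powRN -/(marginal P _) EFinM fineK// lee_pdivrMr ?powR_gt0//.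
by rewrite (le_trans h)// lee_fin mulrC.
Qed.

(** Otherwise the marginals would dominate a multiple of the harmonic series. *)
Lemma power_class_exponent alpha P : power_class alpha P -> 1 < alpha.
Proof.
move=> PW; have [c c0 [k0 H]] := power_class_lower PW.
rewrite ltNge; apply/negP => a1; apply: (@dvg_harmonic R).
have hk k : (k0 <= k)%N -> harmonic k <= c^-1 * marginal P (npos_succ k).
  move=> /H; rewrite -ler_pdivlMl//; apply: le_trans => /=.
  rewrite -powR_inv1//; apply: ler_powR; first by rewrite ler1n.
  by rewrite lerN2.
apply: nondecreasing_is_cvgn.
  by apply: nondecreasing_series => n _; rewrite harmonic_ge0.
exists (\sum_(0 <= k < k0) harmonic k + c^-1) => _ [n _ <-].
rewrite /series/= (le_trans (y := \sum_(0 <= k < k0 + n) harmonic k))//.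
  rewrite (big_cat_nat (n := n) _ (leq_addl k0 n))//= lerDl.
  by apply: sumr_ge0 => i _; rewrite invr_ge0.
rewrite (big_cat_nat (leq0n k0) (leq_addr n k0))//= lerD2l.
rewrite (le_trans (y := \sum_(k0 <= k < k0 + n) c^-1 * marginal P (npos_succ k)))//.
  by apply: ler_sum_nat => k /andP[+ _]; exact: hk.
rewrite -mulr_sumr -[leRHS]mulr1 ler_pM2l ?invr_gt0// -lee_fin -(total_marginal P).
rewrite -(big_map npos_succ xpredT (marginal P)) sum_le_total//.
  by rewrite (map_inj_uniq npos_succ_inj) iota_uniq.
by move=> a; exact: law_ge0.
Qed.

Lemma power_class_upper alpha P a : power_class alpha P ->
  marginal P a <= (val a)%:R `^ (- alpha).
Proof. by move=> [[_ +] _ _ _]; exact. Qed.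

End PowerClass.

(** * Probability that given symbols are missing from a sample *)

Section Avoid.
Variables (R : realType) (T : choiceType).

Lemma total_pred1 (f : T -> R) (b : T) : 0 <= f b ->
  total (fun a => (a == b)%:R * f a) = (f b)%:E.
Proof.
move=> fb; rewrite -[RHS](@esum_set1 R T b (fun x => (f x)%:E)) ?lee_fin//.
rewrite [RHS]esum_mkcond; apply: eq_esum => a _.
case: (eqVneq a b) => [->|ab]; first by rewrite mul1r ifT// inE.
by rewrite mul0r ifF//; apply/negbTE; rewrite notin_setE /=; apply/eqP.
Qed.

Lemma total_mem (f : T -> R) (s : seq T) : uniq s -> (forall a, 0 <= f a) ->
  total (fun a => (a \in s)%:R * f a) = (\sum_(a <- s) f a)%:E.
Proof.
move=> + f0; elim: s => [_|b s IH /= /andP[bs us]].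
  by rewrite big_nil; apply: esum1 => a _; rewrite mul0r.
rewrite big_cons EFinD -IH// -total_pred1// -totalD => [|a|a]; rewrite ?mulr_ge0//.
apply: eq_total => a; rewrite -mulrDl in_cons; congr (_ * _).
by case: eqVneq => [->|_]; rewrite ?(negbTE bs) ?addr0 ?add0r.
Qed.

Variable p : T -> R.
Hypothesis p_ge0 : forall a, 0 <= p a.
Hypothesis p_total : total p = 1%E.

Lemma total_notin (s : seq T) : uniq s ->
  total (fun a => p a * (a \notin s)%:R) = (1 - \sum_(a <- s) p a)%:E.
Proof.
move=> us; rewrite EFinB -p_total -total_mem//.
rewrite (_ : total p = (total (fun a => p a * (a \notin s)%:R)%R + total (fun a => (a \in s)%:R * p a)%R)%E).
  by rewrite addeK// total_mem.
rewrite -totalD => [|a|a]; rewrite ?mulr_ge0//.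
by apply: eq_total => a; case: (a \in s); rewrite !(mulr0, mulr1, mul0r, mul1r, addr0, add0r).
Qed.

Lemma total_iid_avoid n (s : seq T) : uniq s ->
  total (fun x : n.-tuple T => iid p x * (all (fun a => a \notin s) x)%:R) =
  ((1 - \sum_(a <- s) p a) ^+ n)%:E.
Proof.
move=> us; rewrite -(@total_iid_prod _ _ _ p_ge0 n (fun a => (a \notin s)%:R))//.
  apply: eq_total => x; congr (_ * _).
  rewrite -(big_tuple _ _ x xpredT (fun a => (a \notin s)%:R)).
  elim: (tval x) => [|a t IH]; first by rewrite big_nil.
  by rewrite big_cons/= -IH -natrM mulnb.
exact: total_notin.
Qed.

Lemma total_iid_mem n a :
  total (fun x : n.-tuple T => iid p x * (a \in val x)%:R) =
  (1 - (1 - p a) ^+ n)%:E.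
Proof.
have := @total_iid_avoid n [:: a] isT; rewrite big_seq1 => E.
rewrite EFinB -E -(@total_iid _ _ _ p_ge0 p_total n).
have -> : total (@iid R T p n) = (total (fun x : n.-tuple T => iid p x * (a \in val x)%:R)%R
   + total (fun x : n.-tuple T => iid p x * (all (fun b => b \notin [:: a]) x)%:R)%R)%E.
  rewrite -totalD => [|x|x]; rewrite ?mulr_ge0 ?iid_ge0//.
  apply: eq_total => x; rewrite -mulrDr (_ : _ + _ = 1) ?mulr1//.
  have -> : all (fun b => b \notin [:: a]) x = (a \notin val x).
    rewrite -has_pred1 -all_predC; apply: eq_all => b /=; by rewrite mem_seq1.
  by case: (a \in val x); rewrite ?addr0 ?add0r.
by rewrite addeK// E.
Qed.

End Avoid.

(** * Recoding pairs of symbols *)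

Section PairRecoding.
Variables (m : nat) (m_gt0 : (0 < m)%N) (theta : {ffun 'I_m -> bool}).

(** The pairs are [2(m+i)], [2(m+i)+1] for [i < m]; [b] selects the member. *)
Definition pair_symbol (i : 'I_m) (b : bool) : npos :=
  npos_succ ((m + i).*2 + b).-1.

Lemma val_pair_symbol i b : val (pair_symbol i b) = ((m + i).*2 + b)%N.
Proof. by rewrite /= prednK// addn_gt0 double_gt0 addn_gt0 m_gt0. Qed.

Lemma half_pair_symbol i b : (val (pair_symbol i b))./2 = (m + i)%N.
Proof. by rewrite val_pair_symbol addnC half_bit_double. Qed.

Lemma odd_pair_symbol i b : odd (val (pair_symbol i b)) = b.
Proof. by rewrite val_pair_symbol oddD odd_double addFb; case: b. Qed.

Lemma pair_symbol_neq1 i b : pair_symbol i b != npos_succ 0.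
Proof.
apply/eqP => /(congr1 (fun a : npos => (val a)./2)); rewrite half_pair_symbol /=.
by move/eqP; rewrite addn_eq0 -leqn0 leqNgt m_gt0.
Qed.

(** Even members of a pair go to 1, whose mass is not constrained by the
    envelope; odd members go to the member of the same pair that [theta]
    selects.  Away from the value 1 the map is injective and never increases a
    symbol, so a mass that the envelope allows at the preimage is allowed at
    the image. *)
Definition pair_recode (a : npos) : npos :=
  if [pick i : 'I_m | (val a)./2 == (m + i)%N] is Some i
  then if odd (val a) then pair_symbol i (theta i) else npos_succ 0
  else a.

Variant pair_recode_spec a : npos -> Prop :=
| PairRecodeOdd i of a = pair_symbol i true :
    pair_recode_spec a (pair_symbol i (theta i))
| PairRecodeEven : pair_recode_spec a (npos_succ 0)
| PairRecodeOut of (forall i : 'I_m, (val a)./2 != (m + i)%N) :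
    pair_recode_spec a a.

Lemma pair_recodeP a : pair_recode_spec a (pair_recode a).
Proof.
rewrite /pair_recode; case: pickP => [i /eqP ai|ai]; last first.
  by apply: PairRecodeOut => i; rewrite ai.
case: ifPn => [oa|_]; last exact: PairRecodeEven.
apply: PairRecodeOdd; apply: val_inj; rewrite val_pair_symbol -ai.
by rewrite -[LHS]odd_double_half oa addnC.
Qed.

Lemma pair_recode_true i : pair_recode (pair_symbol i true) = pair_symbol i (theta i).
Proof.
rewrite /pair_recode; case: pickP => [j|/(_ i)]; rewrite half_pair_symbol ?eqxx//.
by rewrite eqn_add2l odd_pair_symbol => /eqP/val_inj ->.
Qed.

Lemma pair_recode_le a : pair_recode a != npos_succ 0 ->
  (val (pair_recode a) <= val a)%N.
Proof.
case: pair_recodeP => [i -> _|/eqP//|//].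
by rewrite !val_pair_symbol leq_add2l; case: (theta i).
Qed.

Lemma pair_recode_inj a b : pair_recode a != npos_succ 0 ->
  pair_recode a = pair_recode b -> a = b.
Proof.
case: pair_recodeP => [i -> _|/eqP//|ai a1].
- case: pair_recodeP => [j -> E|/eqP|bi E].
  + congr pair_symbol; apply/val_inj/eqP; rewrite -(eqn_add2l m).
    by rewrite -(half_pair_symbol i (theta i)) E half_pair_symbol.
  + by rewrite (negbTE (pair_symbol_neq1 _ _)).
  + by have := bi i; rewrite -E half_pair_symbol eqxx.
- case: pair_recodeP => [j -> E|E|bi //].
  + by have := ai j; rewrite E half_pair_symbol eqxx.
  + by rewrite E eqxx in a1.
Qed.

Lemma pair_recode_neg a i : pair_recode a != pair_symbol i (~~ theta i).
Proof.
case: pair_recodeP => [j _||ai].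
- apply/eqP => E.
  have ij : j = i.
    by apply/val_inj/eqP; rewrite -(eqn_add2l m) -(half_pair_symbol j (theta j)) E half_pair_symbol.
  have := odd_pair_symbol j (theta j).
  by rewrite E odd_pair_symbol ij; case: (theta i).
- by rewrite eq_sym pair_symbol_neq1.
- by apply/eqP => E; have := ai i; rewrite E half_pair_symbol eqxx.
Qed.

Lemma pair_recode_id a : (m.*2.*2 <= val a)%N -> pair_recode a = a.
Proof.
move=> ma; rewrite /pair_recode; case: pickP => // i /eqP ai.
have : (m.*2 <= (val a)./2)%N by rewrite -(doubleK m.*2) half_leq.
by rewrite ai -addnn leq_add2l leqNgt ltn_ord.
Qed.

End PairRecoding.

Section PerturbedSource.
Variables (R : realType) (alpha : R) (P : source R).
Hypotheses (alpha_ge0 : 0 <= alpha) (PW : power_class alpha P).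
Variables (m : nat) (m_gt0 : (0 < m)%N) (theta : {ffun 'I_m -> bool}).
Let g := pair_recode theta.
Let p := marginal P.

Let p_ge0 a : 0 <= p a. Proof. exact: law_ge0. Qed.

Lemma recode_pmf_pre a : g a != npos_succ 0 -> recode_pmf g p (g a) = p a.
Proof.
move=> ga; apply: EFin_inj; rewrite -recode_pmfE -(@total_pred1 _ _ p a)//.
apply: eq_total => b; rewrite (_ : (g b == g a) = (b == a))//.
apply/eqP/eqP => [gE|->//].
by apply/esym/(pair_recode_inj m_gt0 ga).
Qed.

Lemma recode_pmf_nopre a : (forall b, g b != a) -> recode_pmf g p a = 0.
Proof.
move=> ga; rewrite /recode_pmf (eq_total (g := fun=> 0)).
  by rewrite /total esum1.
by move=> b; rewrite (negbTE (ga b)) mul0r.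
Qed.

Lemma recode_pmf_total : total (recode_pmf g p) = 1%E.
Proof.
rewrite -(total_marginal (recode g P)); apply: eq_total => a.
by rewrite /marginal law_recode ?/iid ?big_ord_recl ?big_ord0 ?mulr1//; case: PW => -[].
Qed.

Lemma marginal_recode : marginal (recode g P) =1 recode_pmf g p.
Proof.
move=> a.
by rewrite /marginal law_recode ?/iid ?big_ord_recl ?big_ord0 ?mulr1//; case: PW => -[].
Qed.

(** A symbol [a] other than 1 has at most one preimage, and that preimage is at
    least [a], so the envelope is preserved; the symbols from [4m] on are fixed,
    so the inferior and superior limits are. *)
Lemma recode_power_class : power_class alpha (recode g P).
Proof.
have mP : memoryless P by case: PW => -[].
have E k : (m.*2.*2 <= k)%N ->
    scaled_marginal alpha (recode g P) k = scaled_marginal alpha P k.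
  move=> mk; rewrite /scaled_marginal; congr (_ * _)%:E.
  rewrite -/(marginal _ _) -/(marginal P _) marginal_recode.
  have gk : g (npos_succ k) = npos_succ k by rewrite /g pair_recode_id//= ltnW.
  rewrite -[in LHS]gk recode_pmf_pre// gk.
  apply/eqP => /(congr1 val)/= [k0]; move: mk m_gt0; rewrite k0 leqn0 !double_eq0.
  by move/eqP ->.
case: (PW) => _ infP _ supP; split.
- split => [n x|a].
    by rewrite law_recode//; apply: eq_bigr => i _; rewrite -/(marginal _ _) marginal_recode.
  rewrite -/(marginal _ _) marginal_recode.
  case: (eqVneq a (npos_succ 0)) => [->|a1].
    by rewrite /= powR1 -marginal_recode; exact: law_le1.
  have [[b gb]|nb] := pselect (exists b, g b = a).
    rewrite -gb recode_pmf_pre ?gb// (le_trans (power_class_upper b PW))//.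
    have ba : (val a <= val b)%N.
      by rewrite -gb; apply: pair_recode_le; rewrite // -/g gb.
    rewrite !powRN lef_pV2 ?posrE ?powR_gt0 ?ltr0n ?(valP a) ?(valP b)//.
    by apply: ge0_ler_powR; rewrite // ?nnegrE ?ler0n// ler_nat.
  rewrite recode_pmf_nopre ?powR_ge0// => b; apply/eqP => gb; apply: nb.
  by exists b.
- by rewrite (limn_einf_eq E).
- exact: limn_einf_sup.
- by rewrite (limn_esup_eq E).
Qed.

End PerturbedSource.

(** * Minimax redundancy: lower bound *)

Section RedundancyLower.
Variable R : realType.

Lemma log2X2 (k : nat) : log2 (2 ^+ k) = k%:R :> R.
Proof.
by rewrite /log2 lnXn// mulrnAl divff ?gt_eqF ?ln2_gt0.
Qed.

Section Weight.
Variables (m n : nat) (m_gt0 : (0 < m)%N).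
Implicit Types (theta : {ffun 'I_m -> bool}) (x : n.-tuple npos).

(** Where the sample has positive probability under [theta], this is its
    likelihood ratio with respect to the uniform mixture over all [theta]: each
    pair that occurs doubles the ratio, and the wrong member of a pair makes it vanish. *)
Definition pair_weight theta x : R :=
  \prod_(i < m) ((pair_symbol i (~~ theta i) \notin val x)%:R *
                 2 ^+ (pair_symbol i (theta i) \in val x)).

Lemma pair_weight_ge0 theta x : 0 <= pair_weight theta x.
Proof. by apply: prodr_ge0 => i _; rewrite mulr_ge0// exprn_ge0. Qed.

(** Averaged over [theta], each factor is at most 1. *)
Lemma sum_pair_weight x : \sum_theta pair_weight theta x <= 2 ^+ m.
Proof.
rewrite /pair_weight -(bigA_distr_bigA (fun i b =>
  (pair_symbol i (~~ b) \notin val x)%:R * 2 ^+ (pair_symbol i b \in val x))).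
rewrite (_ : 2 ^+ m = \prod_(i < m) 2); last by rewrite prodr_const card_ord.
apply: ler_prod => i _; rewrite sumr_ge0 /=; last first.
  by move=> b _; rewrite mulr_ge0// exprn_ge0.
rewrite big_bool/=.
by case: (pair_symbol i true \in _); case: (pair_symbol i false \in _);
  rewrite /= ?expr1 ?expr0; lra.
Qed.

(** The weights have average at most 1 over [theta], so some [theta] gives [q] a
    weighted mass of at most 1; this [theta] takes the place of the average
    over [theta] in the Bayesian argument. *)
Lemma exists_light_weight (q : n.-tuple npos -> R) : is_pmf q ->
  exists theta, exists2 D, D <= 1 &
    total (fun x => pair_weight theta x * q x) = D%:E.
Proof.
move=> [q0 q1].
have wq0 theta x : 0 <= pair_weight theta x * q x.
  by rewrite mulr_ge0 ?pair_weight_ge0.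
have S : (\sum_theta total (fun x => pair_weight theta x * q x)%R <= (2 ^+ m)%:E)%E.
  rewrite -total_sum// -[leRHS]mule1 -q1 -totalZ ?exprn_ge0//; apply: le_total => x.
  by rewrite -mulr_suml ler_wpM2r// sum_pair_weight.
pose d theta := fine (total (fun x => pair_weight theta x * q x)).
have dE th : total (fun x => pair_weight th x * q x) = (d th)%:E.
  rewrite /d; have [||e ->//] := @total_le_fin R _ (fun x => pair_weight th x * q x) (2 ^+ m).
    exact: wq0.
  apply: le_trans S; rewrite (bigD1 th)//= leeDl// sume_ge0// => i _.
  exact: total_ge0.
have [theta dt] : exists theta, d theta <= 1.
  apply/not_existsP => h; move: S; under eq_bigr do rewrite dE.
  rewrite sumEFin lee_fin leNgt => /negP; apply.
  rewrite (_ : 2 ^+ m = \sum_(theta : {ffun 'I_m -> bool}) 1); last first.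
    by rewrite sumr_const card_ffun card_bool card_ord natrX.
  apply: ltr_sum; last by move=> i _; rewrite ltNge; apply/negP/h.
  by apply/hasP; exists [ffun=> true] => //; rewrite mem_index_enum.
by exists theta, (d theta).
Qed.

End Weight.

Section Bayes.
Variables (alpha : R) (P : source R).
Hypotheses (PW : power_class alpha P).
Variables (m n : nat) (m_gt0 : (0 < m)%N).

(** The expected number of pairs whose odd symbol occurs in a sample of [P]. *)
Definition expected_seen : R :=
  \sum_(i < m) (1 - (1 - marginal P (pair_symbol i true)) ^+ n).

Lemma kl_pair_ge (theta : {ffun 'I_m -> bool}) q D : is_pmf q -> D <= 1 ->
  total (fun x : n.-tuple npos => pair_weight theta x * q x) = D%:E ->
  (expected_seen%:E <= kl (@law R (recode (pair_recode theta) P) n) q)%E.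
Proof.
move=> [q0 q1] D1 DE; set g := pair_recode theta.
have l2 := @ln2_gt0 R.
have mP : memoryless P by case: PW => -[].
set pm := recode_pmf g (marginal P).
have pm0 a : 0 <= pm a by rewrite /pm -(marginal_recode PW) law_ge0.
have pm1 : total pm = 1%E by exact: (recode_pmf_total PW).
pose s (x : n.-tuple npos) : nat := (\sum_(i < m) (pair_symbol i (theta i) \in val x))%N.
have sE : total (fun x : n.-tuple npos => iid pm x * (s x)%:R) =
          (\sum_(i < m) (1 - (1 - pm (pair_symbol i (theta i))) ^+ n))%:E.
  under eq_total do rewrite /s natr_sum mulr_sumr.
  rewrite total_sum => [|i x]; last by rewrite mulr_ge0 ?iid_ge0.
  by rewrite -sumEFin; apply: eq_bigr => i _; rewrite total_iid_mem.
pose c (x : n.-tuple npos) := iid pm x * (s x)%:R + (ln 2)^-1 * iid pm x.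
have c1 : total c = (\sum_(i < m) (1 - (1 - pm (pair_symbol i (theta i))) ^+ n) + (ln 2)^-1)%:E.
  rewrite totalD => [|x|x]; last 2 first.
  - by rewrite mulr_ge0 ?iid_ge0.
  - by rewrite mulr_ge0 ?iid_ge0 ?invr_ge0 ?ltW.
  by rewrite sE totalZ ?total_iid ?mule1// invr_ge0 ltW.
apply: (@le_trans _ _ (total c - ((ln 2)^-1 * D)%:E)%E).
  rewrite c1 -EFinB lee_fin /expected_seen -addrA.
  apply: ler_wpDr.
    by rewrite subr_ge0 -[leRHS]mulr1 ler_pM2l ?invr_gt0.
  apply: ler_sum => i _; rewrite lerD2l lerN2.
  have -> : pm (pair_symbol i (theta i)) = marginal P (pair_symbol i true).
    rewrite -(pair_recode_true m_gt0 theta i) /pm recode_pmf_pre//.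
    by rewrite pair_recode_true ?pair_symbol_neq1.
  by [].
apply: (@kl_ge _ _ _ _ c (fun x => (ln 2)^-1 * (pair_weight theta x * q x))).
- move=> x; rewrite /c addr_ge0 ?mulr_ge0 ?iid_ge0//.
  by rewrite invr_ge0 ltW.
- move=> x; rewrite !mulr_ge0 ?pair_weight_ge0//.
  by rewrite invr_ge0 ltW.
- by rewrite totalZ ?DE// invr_ge0 ltW.
(* the guessed ratio is 2^s, s being the number of pairs that occur *)
move=> x; rewrite law_recode// -/pm /c.
have [px0|pxn0] := eqVneq (iid pm x) 0.
  rewrite px0 /kl_term eqxx mul0r mulr0 addr0 sub0r lee_fin oppr_le0.
  by rewrite !mulr_ge0 ?pair_weight_ge0// invr_ge0 ltW.
have wE : pair_weight theta x = 2 ^+ s x.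
  rewrite /pair_weight big_split/= -expr_sum big1 ?mul1r// => i _.
  case: (boolP (_ \in _)) => //= ix; exfalso; move/eqP: pxn0; apply.
  move: ix => /tnthP[j xj]; rewrite /iid (bigD1 j)//= -xj.
  by rewrite /pm recode_pmf_nopre ?mul0r// => b; exact: pair_recode_neg.
rewrite wE; apply: le_trans (kl_term_ge (c := 2 ^+ s x) _ _ _) => //.
- rewrite lee_fin log2X2 le_eqVlt; apply/orP; left; apply/eqP; ring.
- exact: iid_ge0.
Qed.

Lemma minimax_redundancy_ge :
  (expected_seen%:E <= minimax_redundancy (power_class alpha) n)%E.
Proof.
apply: le_ereal_inf_tmp => _ [q pq <-].
have [theta [D D1 DE]] := exists_light_weight m pq.
apply: (le_trans (kl_pair_ge pq D1 DE)); apply: ereal_sup_ubound.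
exists (recode (pair_recode theta) P) => //; apply: recode_power_class => //.
by rewrite ltW// (lt_trans ltr01)// (power_class_exponent PW).
Qed.

End Bayes.
End RedundancyLower.

(** * Minimax redundancy: finiteness *)

Section Log.
Variable R : realType.
Implicit Types x y d : R.

Lemma log2_ge0 x : 1 <= x -> 0 <= log2 x.
Proof. by move=> x1; rewrite divr_ge0 ?ln_ge0// ler1n. Qed.

Lemma log2M x y : 0 < x -> 0 < y -> log2 (x * y) = log2 x + log2 y.
Proof. by move=> x0 y0; rewrite /log2 lnM ?posrE// mulrDl. Qed.

Lemma log2V x : 0 < x -> log2 x^-1 = - log2 x.
Proof. by move=> x0; rewrite /log2 lnV ?posrE// mulNr. Qed.

Lemma log2_2 : log2 2 = 1 :> R.
Proof. by rewrite /log2 divff// gt_eqF// ln2_gt0. Qed.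

Lemma le_log2 x y : 0 < x -> x <= y -> log2 x <= log2 y.
Proof.
move=> x0 xy; rewrite ler_pM2r ?invr_gt0 ?ln2_gt0//.
by rewrite ler_ln ?posrE// (lt_le_trans x0).
Qed.

Lemma log2_prod n (f : 'I_n -> R) : (forall i, 0 < f i) ->
  log2 (\prod_(i < n) f i) = \sum_(i < n) log2 (f i).
Proof.
elim: n f => [|n IH] f f0; first by rewrite !big_ord0 /log2 ln1 mul0r.
by rewrite !big_ord_recr/= log2M ?prodr_gt0// IH.
Qed.

Lemma ln_le_powR d x : 0 < d -> 0 < x -> ln x <= x `^ d / d.
Proof.
move=> d0 x0; rewrite ler_pdivlMr// mulrC -ln_powR.
by apply/ltW/ln_sublinear; rewrite powR_gt0.
Qed.

End Log.

Section RedundancyFinite.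
Variable R : realType.

Lemma total_powR_le (g : R) : 0 < g ->
  (total (fun a : npos => (val a)%:R `^ (- (1 + g)))%R <= (1 + 1 / g)%:E)%E.
Proof.
move=> g0.
have -> : total (fun a : npos => (val a)%:R `^ (- (1 + g))) =
  total (fun a : npos => (a == npos_succ 0)%:R * (val a)%:R `^ (- (1 + g)) +
    (1 < val a)%N%:R * (val a)%:R `^ (- (1 + g))).
  apply: eq_total => a; have [->|a1] := eqVneq a (npos_succ 0).
    by rewrite /= mul0r mul1r addr0.
  suff -> : (1 < val a)%N by rewrite mul0r mul1r add0r.
  by rewrite ltn_neqAle (valP a) andbT eq_sym.
rewrite totalD => [|a|a]; rewrite ?mulr_ge0 ?powR_ge0//.
rewrite total_pred1 ?powR_ge0//= powR1 EFinD leeD2l//.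
by apply: le_trans (powR_tail_le g0 (ltn0Sn 0)) _; rewrite powR1.
Qed.

(** A marginal whose total is exactly 1 and whose log-loss grows only like
    [log k], hence is integrable under every envelope with exponent above 1. *)
Definition telescoping_pmf (a : npos) : R := ((val a) * (val a).+1)%:R^-1.

Lemma telescoping_pmf_gt0 a : 0 < telescoping_pmf a.
Proof. by rewrite invr_gt0 ltr0n muln_gt0 (valP a). Qed.

Lemma total_telescoping_pmf : total telescoping_pmf = 1%E.
Proof.
have S N : \sum_(0 <= k < N) telescoping_pmf (npos_succ k) = 1 - N.+1%:R^-1.
  elim: N => [|N IH]; first by rewrite big_nil invr1 subrr.
  rewrite big_nat_recr//= IH /telescoping_pmf/= natrM.
  have N1 : (0 : R) < N.+1%:R by rewrite ltr0n.
  by rewrite -(natr1 N.+1); field; rewrite !gt_eqF// addr_gt0.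
apply/eqP; rewrite eq_le; apply/andP; split.
  apply: total_npos_le => [a|N]; first exact/ltW/telescoping_pmf_gt0.
  by rewrite S lerBlDr lerDl invr_ge0.
apply/lee_addgt0Pr => e e0.
pose N := (Num.truncn e^-1)%N.
rewrite -leeBlDr//; apply: (@le_trans _ _ (1 - N.+1%:R^-1)%:E).
  rewrite -EFinB lee_fin lerD2l lerN2 -[leRHS]invrK lef_pV2 ?posrE ?invr_gt0//.
  by rewrite ltW// truncnS_gt.
rewrite -S -(big_map npos_succ xpredT telescoping_pmf); apply: sum_le_total.
  by rewrite (map_inj_uniq npos_succ_inj) iota_uniq.
by move=> a; exact/ltW/telescoping_pmf_gt0.
Qed.

(** An arbitrarily small power absorbs the logarithm. *)
Lemma log2_telescoping_pmf (h : R) a : 0 < h ->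
  - log2 (telescoping_pmf a) <= 2 `^ (h / 2) / (h / 2 * ln 2) * (val a)%:R `^ h.
Proof.
move=> h0; have l2 := @ln2_gt0 R.
have a0 : (0 : R) < (val a)%:R by rewrite ltr0n (valP a).
rewrite -log2V ?telescoping_pmf_gt0// /telescoping_pmf invrK.
apply: (@le_trans _ _ (log2 (2 * ((val a)%:R * (val a)%:R)))).
  apply: le_log2; first by rewrite ltr0n muln_gt0 (valP a).
  by rewrite -!natrM ler_nat; have := valP a; nia.
rewrite /log2 ler_pdivrMr// (le_trans (ln_le_powR (d := h / 2) _ _))//.
- by rewrite divr_gt0.
- by rewrite !mulr_gt0.
rewrite powRM ?mulr_ge0// -[X in (X * X) `^ _]powRr1// -powRD ?(gt_eqF a0) ?implybT//.
rewrite -powRrM (_ : (1 + 1) * (h / 2) = h); last by field.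
rewrite le_eqVlt; apply/orP; left; apply/eqP; field.
by rewrite !gt_eqF.
Qed.

(** The coding law is the product of [telescoping_pmf]; [log P^n <= 0] leaves
    only its log-loss, which is additive over the coordinates. *)
Lemma minimax_redundancy_lty (alpha : R) n : 1 < alpha ->
  (minimax_redundancy (power_class alpha) n < +oo)%E.
Proof.
move=> a1; pose h := (alpha - 1) / 2; have h0 : 0 < h by rewrite /h; lra.
pose C := 2 `^ (h / 2) / (h / 2 * ln 2) : R.
have C0 : 0 <= C.
  rewrite divr_ge0 ?powR_ge0// mulr_ge0//; first by rewrite divr_ge0// ltW.
  exact/ltW/ln2_gt0.
apply: (@le_lt_trans _ _ (n%:R * (C * (1 + 1 / h)))%:E); last by rewrite ltry.
apply: ge_ereal_inf; exists (ereal_sup [set kl (@law R P n) (@iid R _ telescoping_pmf n) |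
  P in power_class alpha]).
  exists (@iid R _ telescoping_pmf n) => //; split => [x|].
    by apply: iid_ge0 => a; exact/ltW/telescoping_pmf_gt0.
  apply: total_iid => [a|]; first exact/ltW/telescoping_pmf_gt0.
  exact: total_telescoping_pmf.
apply: ge_ereal_sup => _ [P PW <-].
have mP : memoryless P by case: PW => -[].
have p0 a : 0 <= marginal P a by exact: law_ge0.
pose f (a : npos) : R := C * (val a)%:R `^ h.
have f0 a : 0 <= f a by rewrite mulr_ge0 ?powR_ge0.
have pf : (total (fun a => marginal P a * f a)%R <= (C * (1 + 1 / h))%:E)%E.
  rewrite EFinM (le_trans _ (lee_wpmul2l _ (total_powR_le h0))) ?lee_fin//.
  rewrite -totalZ//; apply: le_total => a.
  rewrite /f mulrCA ler_wpM2l//.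
  rewrite (_ : - (1 + h) = - alpha + h); last by rewrite /h; field.
  rewrite powRD; last by rewrite pnatr_eq0 (gtn_eqF (valP a)) implybT.
  by rewrite ler_wpM2r ?powR_ge0// power_class_upper.
have [|d dE /andP[d0 dC]] := total_le_fin _ pf.
  by move=> a; rewrite mulr_ge0.
apply: (@le_trans _ _ (n%:R * d)%:E); last by rewrite lee_fin ler_wpM2l.
rewrite -(total_iid_sum p0 (total_marginal P) n f0 dE).
apply: kl_le => [x|x]; first by rewrite mulr_ge0 ?iid_ge0 ?sumr_ge0.
rewrite law_memoryless//; have [x0|xn0] := eqVneq (iid (marginal P) x) 0.
  by rewrite x0 /kl_term eqxx mul0r.
have r0 : 0 < iid telescoping_pmf x :> R.
  by apply: prodr_gt0 => i _; exact: telescoping_pmf_gt0.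
have x0 : 0 < iid (marginal P) x by rewrite lt_def xn0 iid_ge0.
rewrite /kl_term (negbTE xn0) gt_eqF// lee_fin ler_pM2l//.
have rE : - log2 (iid telescoping_pmf x) =
    \sum_(i < n) - log2 (telescoping_pmf (tnth x i)) :> R.
  by rewrite log2_prod ?sumrN// => i; exact: telescoping_pmf_gt0.
rewrite log2M ?invr_gt0// log2V// rE ler_wnDl//; last first.
  by apply: ler_sum => i _; exact: log2_telescoping_pmf.
rewrite /log2 pmulr_lle0 ?invr_gt0 ?ln2_gt0// ln_le0//.
by rewrite -[X in X <= _]law_memoryless// law_le1.
Qed.

End RedundancyFinite.

(** * Krichevsky-Trofimov probabilities and likelihoods *)

Section KT.
Variable R : realType.
Local Notation kt := (@kt_prob R).

Lemma kt_prob_rcons K y a : kt K (rcons y a) =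
  kt K y * (((count_mem a y)%:R + 1 / 2) / ((size y)%:R + K.+1%:R / 2)).
Proof.
rewrite /kt_prob size_rcons big_ord_recr/=; congr (_ * _).
  apply: eq_bigr => i _; rewrite nth_rcons ltn_ord.
  by rewrite -cats1 takel_cat// ltnW.
by rewrite nth_rcons ltnn eqxx -cats1 take_size_cat.
Qed.

Lemma kt_prob_ge0 K y : 0 <= kt K y.
Proof. by apply: prodr_ge0 => i _; rewrite divr_ge0// addr_ge0// divr_ge0. Qed.

Lemma kt_prob_gt0 K y : 0 < kt K y.
Proof.
apply: prodr_gt0 => i _; apply: divr_gt0; exact: ltr_wpDl.
Qed.

(** The product of [t + 1/2] over [t < c] is at least [c! / (c + 1)]; passing
    to factorials is what connects the code with multinomial coefficients. *)
Lemma kt_prob_fact K y : all (fun a => (a <= K)%N) y ->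
  \prod_(j < K.+1) ((count_mem (j : nat) y)`!%:R / (count_mem (j : nat) y).+1%:R) <=
  kt K y * \prod_(i < size y) (i%:R + K.+1%:R / 2).
Proof.
elim/last_ind: y => [_|y a IH].
  rewrite /kt_prob /= !big_ord0 mulr1 big1// => i _; rewrite fact0 divr1//.
rewrite all_rcons => /andP[aK yK].
rewrite kt_prob_rcons size_rcons [X in _ <= _ * X]big_ord_recr/=.
set x : R := (size y)%:R + K.+1%:R / 2; have x0 : 0 < x.
  by apply: ltr_wpDl.
set c := (count_mem a y)%:R + 1 / 2.
rewrite (_ : kt K y * (c / x) * _ = (kt K y * \prod_(i < size y) (i%:R + K.+1%:R / 2)) * c);
  last by field; rewrite gt_eqF.
have aK1 : (a < K.+1)%N by [].
have c0 : 0 <= c by rewrite addr_ge0// divr_ge0.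
apply: (le_trans _ (ler_wpM2r c0 (IH yK))).
rewrite [leLHS](bigD1 (Ordinal aK1))//= [X in _ <= X * _](bigD1 (Ordinal aK1))//=.
rewrite [leRHS]mulrAC; apply: ler_pM.
- by rewrite divr_ge0.
- by apply: prodr_ge0 => i _; rewrite divr_ge0.
- rewrite -cats1 count_cat/= eqxx addn0 addn1 factS /c; set k := count_mem a y.
  rewrite natrM -(natr1 k.+1) -(natr1 k); set u : R := k%:R; set f : R := k`!%:R.
  have u0 : 0 <= u by [].
  have f0 : 0 < f by rewrite ltr0n fact_gt0.
  have -> : (u + 1) * f / (u + 1 + 1) = f * ((u + 1) / (u + 1 + 1)) by field; lra.
  have -> : f / (u + 1) * (u + 1 / 2) = f * ((u + 1 / 2) / (u + 1)) by field; lra.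
  rewrite ler_pM2l// ler_pdivrMr; last by lra.
  rewrite mulrAC ler_pdivlMr; last by lra.
  nra.
- apply: ler_prod => i ia; rewrite divr_ge0//=.
  rewrite -cats1 count_cat/= (_ : (a == i) = false) ?addn0//.
  by apply/negbTE; apply: contraNneq ia => ai; apply/eqP/val_inj.
Qed.

(** Once [(K+1)/2] is enlarged to [K+1], the product is a rising factorial,
    and raising [K] by one multiplies it by [(n+K+1)/(K+1)]. *)
Lemma prod_rising K n : \prod_(i < n) (i%:R + K.+1%:R / 2) <=
  n`!%:R * (n + K.+1)%:R ^+ K :> R.
Proof.
apply: (@le_trans _ _ (\prod_(i < n) (i + K.+1)%:R)).
  apply: ler_prod => i _; rewrite addr_ge0 ?divr_ge0//= natrD lerD2l.
  by rewrite ler_pdivrMr// ler_peMr// ler1n.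
elim: K => [|K IH].
  rewrite expr0 mulr1; elim: n => [|n IHn]; first by rewrite big_ord0.
  by rewrite big_ord_recr/= factS natrM mulrC addn1 ler_wpM2l.
have -> : \prod_(i < n) (i + K.+2)%:R =
    (\prod_(i < n) (i + K.+1)%:R) * ((n + K.+1)%:R / K.+1%:R) :> R.
  clear IH; elim: n => [|n IHn].
    by rewrite !big_ord0 mul1r divff// pnatr_eq0.
  rewrite !big_ord_recr/= IHn addSnnS.
  have h1 : (n + K.+1)%:R != 0 :> R by rewrite pnatr_eq0 addnS.
  have h2 : K.+1%:R != 0 :> R by rewrite pnatr_eq0.
  by field.
rewrite exprSr [leRHS]mulrA; apply: ler_pM.
- by apply: prodr_ge0.
- by rewrite divr_ge0.
- apply: (le_trans IH); rewrite ler_wpM2l// lerXn2r ?nnegrE// ler_nat; lia.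
- rewrite ler_pdivrMr// (@le_trans _ _ (n + K.+2)%:R)//.
    by rewrite ler_nat; lia.
  by rewrite ler_peMr// ler1n.
Qed.

(** One term of the multinomial expansion is at most the whole. *)
Lemma multinomial_term_le (s : seq nat) (c : nat -> nat) (w : nat -> R) :
  (forall j, 0 <= w j) ->
  (\sum_(j <- s) c j)`!%:R * \prod_(j <- s) w j ^+ c j <=
  \prod_(j <- s) (c j)`!%:R * (\sum_(j <- s) w j) ^+ (\sum_(j <- s) c j)%N.
Proof.
move=> w0; elim: s => [|j s IH]; first by rewrite !big_nil expr0.
rewrite !big_cons; set S := (\sum_(j <- s) c j)%N in IH *.
set W := \sum_(j <- s) w j in IH *; set F := \prod_(j <- s) _ in IH *.
set G := \prod_(j <- s) (c j)`!%:R in IH *.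
have W0 : 0 <= W by exact: sumr_ge0.
have bin : (w j) ^+ c j * W ^+ S *+ 'C(c j + S, c j) <= (w j + W) ^+ (c j + S).
  rewrite addrC exprDn.
  have cS : (c j < (c j + S).+1)%N by rewrite ltnS leq_addr.
  rewrite (bigD1 (Ordinal cS))//= addKn mulrC lerDl sumr_ge0// => i _.
  by rewrite mulrn_wge0// mulr_ge0 ?exprn_ge0.
have facts : (c j + S)`!%:R = 'C(c j + S, c j)%:R * (c j)`!%:R * S`!%:R :> R.
  by rewrite -!natrM -(bin_fact (leq_addr S (c j))) addKn mulnA.
rewrite facts; apply: (@le_trans _ _ ('C(c j + S, c j)%:R * (c j)`!%:R * w j ^+ c j * (G * W ^+ S))).
  rewrite (_ : _ * _ * _ * (_ * _) = ('C(c j + S, c j)%:R * (c j)`!%:R * w j ^+ c j) * (S`!%:R * F)); last by ring.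
  by rewrite ler_wpM2l// !mulr_ge0// exprn_ge0.
rewrite (_ : _ * (G * W ^+ S) = ((c j)`!%:R * G) * (w j ^+ c j * W ^+ S *+ 'C(c j + S, c j))); last first.
  by rewrite -[in RHS]mulr_natr; ring.
by rewrite ler_wpM2l// mulr_ge0// prodr_ge0.
Qed.

Lemma sum_count_alphabet K y : all (fun a => (a <= K)%N) y ->
  (\sum_(j < K.+1) count_mem (j : nat) y = size y)%N.
Proof.
elim: y => [_|a s IH /= /andP[aK sK]]; first by rewrite big1.
have aK1 : (a < K.+1)%N by [].
rewrite big_split/= IH// (bigD1 (Ordinal aK1))//= eqxx big1 ?addn0// => i ia.
by rewrite (_ : (a == i) = false)//; apply/negbTE; apply: contraNneq ia => ai; apply/eqP/val_inj.
Qed.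

(** The maximum-likelihood bound on the Krichevsky-Trofimov mixture: both sides
    depend on [y] through its counts only, and the likelihood of all the
    strings with these counts is a multinomial term, at most 1. *)
Lemma kt_prob_lower K y (w : nat -> R) : (forall j, 0 <= w j) ->
  \sum_(j < K.+1) w j <= 1 -> all (fun a => (a <= K)%N) y ->
  \prod_(a <- y) w a <=
  kt K y * ((size y).+1%:R ^+ K.+1 * (size y + K.+1)%:R ^+ K).
Proof.
move=> w0 w1 yK; set n := size y; pose c j := count_mem j y.
have cn : (\sum_(j < K.+1) c j = n)%N.
  exact: sum_count_alphabet.
have -> : \prod_(a <- y) w a = \prod_(j < K.+1) w j ^+ c j.
  rewrite /c; elim: (y) yK => [_|a s IH /= /andP[aK sK]].
    by rewrite big_nil big1// => i _; rewrite expr0.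
  have aK1 : (a < K.+1)%N by [].
  rewrite big_cons IH//; under [RHS]eq_bigr do rewrite exprD.
  rewrite big_split/=; congr (_ * _).
  rewrite (bigD1 (Ordinal aK1))//= eqxx expr1 big1 ?mulr1// => i ia.
  by rewrite (_ : (a == i) = false)//; apply/negbTE; apply: contraNneq ia => ai; apply/eqP/val_inj.
have n0 : (0 : R) < n`!%:R by rewrite ltr0n fact_gt0.
rewrite -(ler_pM2l n0).
apply: (@le_trans _ _ (\prod_(j < K.+1) (c j)`!%:R)).
  have := @multinomial_term_le (index_iota 0 K.+1) c w w0.
  rewrite !big_mkord cn => /le_trans; apply.
  rewrite ler_piMr ?prodr_ge0//.
  by rewrite exprn_ile1// sumr_ge0.
have := kt_prob_fact yK; rewrite -/n.
under eq_bigr do rewrite -/(c _).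
rewrite big_split/= => H.
have cK : \prod_(j < K.+1) ((c j).+1%:R)^-1 >= n.+1%:R ^- K.+1 :> R.
  rewrite -exprVn (_ : _ ^+ K.+1 = \prod_(j < K.+1) n.+1%:R^-1); last first.
    by rewrite prodr_const card_ord.
  apply: ler_prod => j _; rewrite invr_ge0 ler0n/= lef_pV2 ?posrE// ler_nat ltnS.
  exact: count_size.
rewrite [leRHS](_ : _ = kt K y * (n`!%:R * (n + K.+1)%:R ^+ K) * n.+1%:R ^+ K.+1); last by ring.
rewrite -ler_pdivrMr ?exprn_gt0//.
apply: (@le_trans _ _ (\prod_(j < K.+1) (c j)`!%:R * \prod_(j < K.+1) (c j).+1%:R^-1)).
  by rewrite ler_wpM2l// prodr_ge0.
by rewrite (le_trans H)// ler_wpM2l ?kt_prob_ge0// prod_rising.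
Qed.

End KT.

(** * Elias lengths and the Kraft inequality of the code *)

Section Elias.
Variable R : realType.
Local Notation elias := (elias_length R).

Let elias_real (j : nat) : R := log2 (j%:R : R) + 2 * log2 (1 + log2 j%:R) + 1.

Lemma log2_nat_ge0 (j : nat) : 0 <= log2 (j%:R : R).
Proof.
case: j => [|j]; first by rewrite /log2 ln0// mul0r.
by rewrite log2_ge0// ler1n.
Qed.

(** [log2 (1 + x) <= 2 x], because [ln 2 >= 1/2]. *)
Lemma elias_length_le j : (elias j)%:R <= 1 + 5 * log2 (j%:R : R).
Proof.
have l0 := log2_nat_ge0 j; have l2 := @ln2_gt0 R.
have l1 : log2 (1 + log2 (j%:R : R)) <= 2 * log2 (j%:R : R).
  rewrite /log2 ler_pdivrMr// -/(log2 _); apply: (le_trans (le_ln1Dx _)).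
    by rewrite (lt_le_trans _ l0).
  rewrite mulrAC ler_peMl//.
  have h : ln (1 + (2^-1 - 1)) <= 2^-1 - 1 :> R by apply: le_ln1Dx; lra.
  rewrite (_ : 1 + (2^-1 - 1) = 2^-1) in h; last by lra.
  by rewrite lnV ?posrE// in h; lra.
have l3 : 0 <= log2 (1 + log2 (j%:R : R)) by rewrite log2_ge0// lerDl.
have e0 : 0 <= elias_real j by rewrite /elias_real; lra.
apply: (@le_trans _ _ (elias_real j)); first by rewrite truncn_le.
by rewrite /elias_real; lra.
Qed.

Lemma elias_length_homo j k : (0 < j)%N -> (j <= k)%N -> (elias j <= elias k)%N.
Proof.
move=> j0 jk; apply: le_truncn; rewrite lerD2r.
have jR : (0 : R) < j%:R by rewrite ltr0n.
have ljk : log2 (j%:R : R) <= log2 k%:R by rewrite le_log2// ler_nat.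
rewrite lerD// ler_pM2l// le_log2 ?lerD2l//.
by rewrite ltr_wpDr// log2_nat_ge0.
Qed.

Lemma elias_weight_le j : (0 < j)%N ->
  2 ^- elias j <= (j%:R * (1 + log2 (j%:R : R)) ^+ 2)^-1.
Proof.
move=> j0; have jR : (0 : R) < j%:R by rewrite ltr0n.
have l0 : 0 < 1 + log2 (j%:R : R) by rewrite ltr_wpDr// log2_nat_ge0.
have p0 : 0 < j%:R * (1 + log2 (j%:R : R)) ^+ 2 by rewrite mulr_gt0 ?exprn_gt0.
rewrite lef_pV2 ?posrE ?exprn_gt0//.
rewrite -ler_ln ?posrE ?exprn_gt0// -(@ler_pM2r _ (ln 2)^-1) ?invr_gt0 ?ln2_gt0//.
rewrite -/(log2 _) -/(log2 (2 ^+ _)) log2X2.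
rewrite log2M ?exprn_gt0// expr2 log2M//.
have : elias_real j < (elias j).+1%:R by exact: truncnS_gt.
by rewrite -natr1 ltrD2r /elias_real mulr_natl mulr2n => /ltW.
Qed.

Let V (k : nat) : R := (1 + log2 (k%:R : R))^-1.

(** The potential is [1 / (1 + log k)], and [log (k+1) - log k] is at least
    [1 / (k+1)] because [ln 2 <= 1]. *)
Lemma elias_weight_step k : (0 < k)%N -> 2 ^- elias k.+1 <= V k - V k.+1.
Proof.
move=> k0; apply: (le_trans (elias_weight_le (ltn0Sn k))).
have kR : (0 : R) < k%:R by rewrite ltr0n.
have k1R : (0 : R) < k.+1%:R by rewrite ltr0n.
have l0 := log2_nat_ge0 k; have l1 := log2_nat_ge0 k.+1.
have l01 : log2 (k%:R : R) <= log2 k.+1%:R by rewrite le_log2// ler_nat.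
have dl : k.+1%:R^-1 <= log2 (k.+1%:R : R) - log2 k%:R.
  rewrite -mulrBl ler_pdivlMr ?ln2_gt0//.
  apply: (@le_trans _ _ (k.+1%:R^-1)).
    rewrite ler_piMr ?invr_ge0//.
    have h : ln (1 + 1) <= 1 :> R by apply: le_ln1Dx; lra.
    by rewrite (_ : 1 + 1 = 2) in h; last lra.
  rewrite -ln_div ?posrE// -[leRHS]opprK -lnV ?posrE ?divr_gt0// invf_div lerNr.
  rewrite (_ : k%:R / _ = 1 + (- k.+1%:R^-1)).
    by apply: le_ln1Dx; rewrite ltrN2 invf_lt1// ltr1n ltnS.
  by rewrite -natr1; field; rewrite natr1 gt_eqF.
rewrite /V; set a := log2 (k%:R : R) in l0 l01 dl *.
set b := log2 (k.+1%:R : R) in l1 l01 dl *.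
have a1 : 0 < 1 + a by rewrite ltr_wpDr.
have b1 : 0 < 1 + b by rewrite ltr_wpDr.
rewrite (_ : (1 + a)^-1 - (1 + b)^-1 = (b - a) / ((1 + a) * (1 + b))); last first.
  by field; rewrite !gt_eqF.
rewrite invfM; apply: ler_pM => //; rewrite ?invr_ge0 ?exprn_ge0//; first exact: ltW.
by rewrite lef_pV2 ?posrE ?exprn_gt0 ?mulr_gt0// expr2 ler_pM2r// lerD2l.
Qed.

(** Beyond the symbol 1 the Elias weights sum to at most 1 without any extra
    constant, which matters because the bound is used once per symbol. *)
Lemma elias_tail_le1 b : (0 < b)%N ->
  (total (fun a : npos => (b < val a)%:R * 2 ^- elias (val a) : R)%R <= 1%:E)%E.
Proof.
have V0 k : 0 <= V k by rewrite invr_ge0 addr_ge0// log2_nat_ge0.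
move=> b0; apply: (@le_trans _ _ (V b)%:E).
  apply: tail_total_le => [a|//|k bk]; first by rewrite invr_ge0 exprn_ge0.
  by apply: elias_weight_step; exact: leq_trans bk.
by rewrite lee_fin invf_le1 ?lerDl ?log2_nat_ge0// ltr_wpDr// log2_nat_ge0.
Qed.

Lemma elias_total_le2 : (total (fun a : npos => 2 ^- elias (val a) : R)%R <= 2%:E)%E.
Proof.
have -> : total (fun a : npos => 2 ^- elias (val a) : R) =
  total (fun a : npos => (a == npos_succ 0)%:R * 2 ^- elias (val a) +
    (1 < val a)%N%:R * 2 ^- elias (val a) : R).
  apply: eq_total => a; have [->|a1] := eqVneq a (npos_succ 0).
    by rewrite /= mul0r mul1r addr0.
  suff -> : (1 < val a)%N by rewrite mul0r mul1r add0r.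
  by rewrite ltn_neqAle (valP a) andbT eq_sym.
rewrite totalD => [|a|a]; rewrite ?mulr_ge0 ?invr_ge0 ?exprn_ge0//.
rewrite total_pred1 ?invr_ge0 ?exprn_ge0// (_ : 2%:E = (1%:E + 1%:E)%E)//.
by apply: leeD; rewrite ?elias_tail_le1// lee_fin invf_le1 ?exprn_gt0// exprn_ege1// ler1n.
Qed.

End Elias.

Section Kraft.
Variable R : realType.
Local Notation elias := (elias_length R).
Local Notation kt := (@kt_prob R).

(** The probability that the code would assign with a cutoff [K] fixed in
    advance and an ideal arithmetic coder. *)
Definition censored_prob K (s : seq npos) : R :=
  (\prod_(a <- s | (K < val a)%N) 2 ^- elias (val a)) * kt K (censor K s).

Lemma censored_prob_ge0 K s : 0 <= censored_prob K s.
Proof.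
by rewrite mulr_ge0 ?kt_prob_ge0// prodr_ge0// => a _; rewrite invr_ge0 exprn_ge0.
Qed.

Lemma censor_le K s : all (fun a => (a <= K)%N) (censor K s).
Proof. by apply/allP => a /mapP[b _ ->]; case: ifP. Qed.

Lemma size_censor K s : size (censor K s) = size s.
Proof. exact: size_map. Qed.

Let cond K (y : seq nat) (j : nat) : R :=
  ((count_mem j y)%:R + 1 / 2) / ((size y)%:R + K.+1%:R / 2).

Let cond_ge0 K y j : 0 <= cond K y j.
Proof. by rewrite divr_ge0// addr_ge0// divr_ge0. Qed.

Lemma censored_prob_rcons K s a : censored_prob K (rcons s a) =
  censored_prob K s *
   ((K < val a)%N%:R * 2 ^- elias (val a) * cond K (censor K s) 0 +
    (val a <= K)%N%:R * cond K (censor K s) (val a)).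
Proof.
rewrite /censored_prob -cats1 big_cat big_cons big_nil /= /censor map_cat/= cats1.
rewrite kt_prob_rcons -/(cond _ _ _) ltnNge.
by case: (val a <= K)%N => /=; ring.
Qed.

(** One step of the code with a fixed cutoff: the mass of the escape symbol 0
    is spread over the symbols above [K] by their Elias weights. *)
Lemma total_cond_le1 K y : (0 < K)%N -> all (fun a => (a <= K)%N) y ->
  (total (fun a : npos => (K < val a)%N%:R * 2 ^- elias (val a) * cond K y 0 +
    (val a <= K)%N%:R * cond K y (val a))%R <= 1%:E)%E.
Proof.
move=> K0 yK; pose s := [seq npos_succ k | k <- index_iota 0 K].
have us : uniq s by rewrite (map_inj_uniq npos_succ_inj) iota_uniq.
have sE (a : npos) : (val a <= K)%N = (a \in s).
  apply/idP/mapP => [aK|[k + ->]]; last by rewrite mem_index_iota.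
  exists (val a).-1; last by rewrite npos_succK.
  by rewrite mem_index_iota/= prednK// (valP a).
rewrite totalD => [|a|a]; rewrite ?mulr_ge0 ?invr_ge0 ?exprn_ge0//.
have -> : total (fun a : npos => (val a <= K)%:R * cond K y (val a)) =
    (\sum_(0 <= k < K) cond K y k.+1)%:E.
  rewrite -[in RHS](big_map npos_succ xpredT (fun a => cond K y (val a))) -total_mem//.
  by apply: eq_total => a; rewrite sE.
apply: (@le_trans _ _ (cond K y 0 + \sum_(0 <= k < K) cond K y k.+1)%:E); last first.
  rewrite lee_fin -(@big_nat_recl _ _ _ K 0 (cond K y))// big_mkord /cond.
  rewrite -mulr_suml big_split/= -natr_sum sum_count_alphabet// sumr_const card_ord.
  rewrite mul1r -[X in _ + X]mulr_natl ler_pdivrMr ?mul1r //; exact: ltr_wpDl.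
rewrite EFinD leeD2r//.
under eq_total do rewrite mulrC.
rewrite totalZ// -[leRHS]mule1 lee_wpmul2l ?lee_fin//.
exact: elias_tail_le1.
Qed.

Lemma total_censored_prob_le1 K n : (0 < K)%N ->
  (total (fun x : n.-tuple npos => censored_prob K x) <= 1%:E)%E.
Proof.
move=> K0; elim: n => [|n IH].
  rewrite total_tuple0 ?lee_fin => [|x]; last exact: censored_prob_ge0.
  by rewrite /censored_prob big_nil mul1r /kt_prob big_ord0.
rewrite total_rcons => [|x]; last exact: censored_prob_ge0.
apply: le_trans IH; apply: le_esum => t _.
under eq_total do rewrite censored_prob_rcons.
rewrite totalZ ?censored_prob_ge0// -[leRHS]mule1.
by rewrite lee_wpmul2l ?lee_fin ?censored_prob_ge0// total_cond_le1// censor_le.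
Qed.

Variables (arith : nat -> seq nat -> nat) (mu : R).
Hypothesis arithP : kt_arithmetic_length R arith.

Lemma cutoff_gt0 s : (0 < cutoff mu s)%N.
Proof. by rewrite leq_max. Qed.

Lemma ac_coding_prob_ge0 n (x : n.-tuple npos) : 0 <= ac_coding_prob arith mu x.
Proof. by rewrite invr_ge0 exprn_ge0. Qed.

(** Rounding by the arithmetic coder loses at most a factor 2. *)
Lemma ac_coding_prob_le n (x : n.-tuple npos) :
  ac_coding_prob arith mu x <=
  2 * 2 ^- elias (cutoff mu x) * censored_prob (cutoff mu x) x.
Proof.
rewrite /ac_coding_prob /ac_length; set K := cutoff mu x.
have := arithP (cutoff_gt0 x) (censor_le (cutoff mu x) x).
rewrite -/K ltr_norml => /andP[h _].
have ak : 2 ^- arith K (censor K x) <= 2 * kt K (censor K x).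
  have k0 := kt_prob_gt0 R K (censor K x).
  rewrite -[leRHS]invrK lef_pV2 ?posrE ?invr_gt0 ?exprn_gt0 ?mulr_gt0//.
  rewrite -ler_ln ?posrE ?invr_gt0 ?exprn_gt0 ?mulr_gt0//.
  rewrite -(@ler_pM2r _ (ln 2)^-1) ?invr_gt0 ?ln2_gt0//.
  rewrite -/(log2 _) -/(log2 (2 ^+ _)) log2X2 log2V ?mulr_gt0// log2M// log2_2; lra.
rewrite -[leLHS]exprVn !exprD expr_sum /censored_prob.
under eq_bigr do rewrite exprVn.
rewrite !exprVn; set G := \prod_(a <- x | _) _.
have G0 : 0 <= G by apply: prodr_ge0 => a _; rewrite invr_ge0 exprn_ge0.
rewrite (_ : 2 * _ * _ = 2 ^- elias K * G * (2 * kt K (censor K x))); last by ring.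
by rewrite ler_wpM2l// mulr_ge0// invr_ge0 exprn_ge0.
Qed.

Lemma cutoff_le (s : seq npos) n : size s = n ->
  (cutoff mu s <= maxn 1 (Num.truncn (`|mu| * n%:R)))%N.
Proof.
move=> sn; rewrite /cutoff geq_max leq_maxl/= leq_max; apply/orP; right.
apply: le_truncn; rewrite (le_trans (ler_wpM2r _ (ler_norm mu)))//.
by rewrite ler_wpM2l// ler_nat -sn size_undup.
Qed.

(** The cutoff is itself encoded, so the sum over the possible cutoffs is
    weighted by Elias weights; the bound is a factor 2 for their total and a
    factor 2 for the rounding. *)
Lemma kraft_ac_coding n :
  (total (fun x : n.-tuple npos => ac_coding_prob arith mu x) <= 4%:E)%E.
Proof.
pose B := maxn 1 (Num.truncn (`|mu| * n%:R)).
pose f K (x : n.-tuple npos) := 2 * 2 ^- elias K.+1 * censored_prob K.+1 x : R.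
have f0 K x : 0 <= f K x.
  by rewrite /f mulr_ge0 ?censored_prob_ge0// mulr_ge0// invr_ge0 exprn_ge0.
apply: (@le_trans _ _ (total (fun x => \sum_(K <- index_iota 0 B) f K x))).
  apply: le_total => x; apply: (le_trans (ac_coding_prob_le x)).
  have cB : ((cutoff mu x).-1 < B)%N.
    by rewrite prednK ?cutoff_gt0// cutoff_le// size_tuple.
  rewrite (bigD1_seq (cutoff mu x).-1) ?iota_uniq ?mem_index_iota//=.
  by rewrite {1}/f prednK ?cutoff_gt0// lerDl sumr_ge0.
rewrite total_sum//.
apply: (@le_trans _ _ (\sum_(K <- index_iota 0 B) (2 * 2 ^- elias K.+1)%:E)%E).
  apply: lee_sum => K _; rewrite totalZ; last by rewrite mulr_ge0// invr_ge0 exprn_ge0.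
  rewrite -[leRHS]mule1 lee_wpmul2l ?total_censored_prob_le1//.
rewrite sumEFin -mulr_sumr EFinM (_ : 4%:E = 2%:E * 2%:E)%E; last first.
  by rewrite -EFinM; congr EFin; rewrite -natrM.
rewrite lee_wpmul2l ?lee_fin//; rewrite -lee_fin; apply: (le_trans _ (@elias_total_le2 R)).
rewrite -(big_map npos_succ xpredT (fun a => 2 ^- elias (val a))).
apply: sum_le_total => [|a]; last by rewrite invr_ge0 exprn_ge0.
by rewrite (map_inj_uniq npos_succ_inj) iota_uniq.
Qed.

Lemma kl_ac_coding_ge (p : npos -> R) n : (forall a, 0 <= p a) ->
  ((- (4 / ln 2))%:E <=
    kl (@iid R _ p n) (fun x => ac_coding_prob arith mu x))%E.
Proof.
move=> p0; have l2 := @ln2_gt0 R.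
have [x|D DE /andP[D0 D4]] := total_le_fin _ (kraft_ac_coding n).
  exact: ac_coding_prob_ge0.
pose c (x : n.-tuple npos) : R := 0.
have c0 : total c = 0%:E by rewrite /total esum1.
apply: (@le_trans _ _ (total c - ((ln 2)^-1 * D)%:E)%E).
  by rewrite c0 sub0e lee_fin lerN2 mulrC ler_pM2r ?invr_gt0.
apply: (@kl_ge _ _ _ _ c (fun x => (ln 2)^-1 * ac_coding_prob arith mu x)) => //.
- by move=> x; rewrite mulr_ge0 ?ac_coding_prob_ge0// invr_ge0 ltW.
- by rewrite totalZ ?DE// invr_ge0 ltW.
move=> x; apply: (le_trans _ (kl_term_ge (iid_ge0 p0 x) (ac_coding_prob_ge0 x) ltr01)).
rewrite lee_fin /c /log2 ln1 mul0r mulr0 sub0r add0r mul1r mulrC lerDr.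
by rewrite divr_ge0 ?iid_ge0// ltW.
Qed.

End Kraft.

(** * Pointwise and expected code length *)

Section CodeLength.
Variables (R : realType) (arith : nat -> seq nat -> nat) (mu : R).
Hypotheses (arithP : kt_arithmetic_length R arith) (mu_gt0 : 0 < mu).
Variable p : npos -> R.
Hypothesis p_ge0 : forall a, 0 <= p a.
Hypothesis p_total : total p = 1%E.
Local Notation elias := (elias_length R).
Local Notation Q := (fun x => ac_coding_prob arith mu x).

(** The law of a symbol of [p] after censoring at [K], 0 being the escape. *)
Definition censored_pmf K (j : nat) : R :=
  if j is k.+1 then p (npos_succ k) else 1 - \sum_(0 <= k < K) p (npos_succ k).

Lemma sum_head_le1 K : \sum_(0 <= k < K) p (npos_succ k) <= 1.
Proof.
rewrite -lee_fin -p_total -(big_map npos_succ xpredT p) sum_le_total//.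
by rewrite (map_inj_uniq npos_succ_inj) iota_uniq.
Qed.

Lemma censored_pmf_ge0 K j : 0 <= censored_pmf K j.
Proof. by case: j => [|j]//=; rewrite subr_ge0 sum_head_le1. Qed.

Lemma sum_censored_pmf K : \sum_(j < K.+1) censored_pmf K j = 1.
Proof. by rewrite -(big_mkord xpredT (censored_pmf K)) big_nat_recl//= subrK. Qed.

Lemma le_censored_pmf K a :
  p a <= censored_pmf K (if (val a <= K)%N then val a else 0%N).
Proof.
case: leqP => aK; first by rewrite -[a in leLHS]npos_succK; case: (val a) (valP a).
rewrite /= lerBrDr -lee_fin -p_total.
rewrite (_ : _ + _ = \sum_(c <- a :: [seq npos_succ k | k <- index_iota 0 K]) p c); last first.
  by rewrite big_cons big_map.
rewrite sum_le_total//= (map_inj_uniq npos_succ_inj) iota_uniq andbT.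
apply/mapP => -[k]; rewrite mem_index_iota => /andP[_ kK] ak.
by move: aK; rewrite ak /= ltnS leqNgt kK.
Qed.

(** The censored string is at least as likely as the sample, so the entropy of
    the symbols above [K] is simply dropped. *)
Lemma kl_term_ac_le n (x : n.-tuple npos) K : K = cutoff mu x ->
  (kl_term (iid p x) (ac_coding_prob arith mu x) <=
   (iid p x * (1 + (elias K)%:R + (\sum_(a <- x | (K < val a)%N) elias (val a))%N%:R
     + 2 * K.+1%:R * log2 (n + K.+1)%:R))%:E)%E.
Proof.
move=> KE; have [->|xn0] := eqVneq (iid p x) 0.
  by rewrite /kl_term eqxx mul0r.
have x0 : 0 < iid p x by rewrite lt_def xn0 iid_ge0.
have Q0 : 0 < ac_coding_prob arith mu x by rewrite invr_gt0 exprn_gt0.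
rewrite /kl_term (negbTE xn0) (gt_eqF Q0) lee_fin ler_pM2l//.
have N0 : (0 : R) < (n + K.+1)%:R by rewrite ltr0n addnS.
have := arithP (cutoff_gt0 mu x) (censor_le (cutoff mu x) x).
rewrite -KE ltr_norml => /andP[_ h].
rewrite /ac_coding_prob invrK log2M ?exprn_gt0// log2X2.
have -> : (ac_length arith mu x)%:R = (elias K)%:R + (\sum_(a <- x | (K < val a)%N) elias (val a))%N%:R
    + (arith K (censor K x))%:R :> R by rewrite /ac_length -KE !natrD.
have k0 := kt_prob_gt0 R K (censor K x).
suff : log2 (iid p x) <= log2 (kt_prob R K (censor K x)) + 2 * K.+1%:R * log2 (n + K.+1)%:R by lra.
have B0 : (0 : R) < n.+1%:R ^+ K.+1 * (n + K.+1)%:R ^+ K by rewrite mulr_gt0 ?exprn_gt0// ltr0n.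
have H : iid p x <= kt_prob R K (censor K x) * (n.+1%:R ^+ K.+1 * (n + K.+1)%:R ^+ K).
  have := kt_prob_lower (censored_pmf_ge0 K) _ (censor_le K x).
  rewrite sum_censored_pmf size_censor size_tuple => /(_ (lexx _)); apply: le_trans.
  rewrite /iid -(big_tuple _ _ x xpredT p) /censor big_map.
  by apply: ler_prod => a _; rewrite p_ge0 le_censored_pmf.
apply: (le_trans (le_log2 x0 H)).
rewrite log2M// lerD2l.
apply: (@le_trans _ _ (log2 ((n + K.+1)%:R ^+ (K.+1 * 2)))).
  apply: le_log2 => //; rewrite mulnC mul2n -addnn exprD ler_pM ?exprn_ge0//.
    by rewrite lerXn2r ?nnegrE// ler_nat; lia.
  by rewrite ler_weXn2l// ler1n addnS.
rewrite /log2 lnXn// -[X in X / _ <= _]mulr_natl [in leLHS]natrM le_eqVlt; apply/orP; left.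
by apply/eqP; ring.
Qed.

(** The number of sets of at least [h/2] symbols among [h+1, .., 2h] that are
    entirely absent from the sample: an upper bound for the indicator that few
    symbols occur. *)
Definition few_symbols h n (x : n.-tuple npos) : R :=
  \sum_(T : {set 'I_h} | (h <= #|T|.*2)%N)
    (all (fun a => a \notin [seq npos_succ (h + i) | i : 'I_h in T]) x)%:R.

(** The symbols of [h+1, .., 2h] that do not occur form one such set. *)
Lemma few_symbols_ge1 h n (x : n.-tuple npos) :
  ((size (undup x)).*2 <= h)%N -> 1 <= few_symbols h x.
Proof.
move=> Zh; pose T := [set i : 'I_h | npos_succ (h + i) \notin val x]%SET.
have TC : (#|~: T|%SET <= size (undup x))%N.
  rewrite cardE -(size_map (fun i : 'I_h => npos_succ (h + i))).
  apply: uniq_leq_size.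
    rewrite map_inj_uniq ?enum_uniq// => i j /npos_succ_inj /eqP.
    by rewrite eqn_add2l => /eqP /val_inj.
  move=> a /mapP[i]; rewrite mem_enum !inE negbK => ix ->.
  by rewrite mem_undup.
have hT : (h <= #|T|.*2)%N.
  have := cardsC T; rewrite card_ord; move: Zh TC; rewrite -!addnn; lia.
rewrite /few_symbols (bigD1 T)//= (_ : all _ _) ?lerDl ?sumr_ge0//.
apply/allP => a ax; apply/mapP => -[i]; rewrite mem_enum inE => + ai.
by rewrite -ai ax.
Qed.

(** Union bound over at most [2^h] sets, each being avoided with probability at
    most [(1 - q h/2)^n]. *)
Lemma total_few_symbols h n (q : R) : 0 <= q ->
  (forall i, (i < h)%N -> q <= p (npos_succ (h + i))) ->
  (total (fun x : n.-tuple npos => iid p x * few_symbols h x)%R <=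
   (2 ^+ h * expR (- (n%:R * q * h%:R / 2)))%:E)%E.
Proof.
move=> q0 pq; rewrite /few_symbols.
pose S (T : {set 'I_h}) := [seq npos_succ (h + i) | i : 'I_h in T].
have uS T : uniq (S T).
  rewrite map_inj_uniq ?enum_uniq// => i j /npos_succ_inj /eqP.
  by rewrite eqn_add2l => /eqP /val_inj.
under eq_total do rewrite big_mkcond/= mulr_sumr.
rewrite total_sum => [|T x]; last by case: ifP; rewrite mulr_ge0 ?iid_ge0.
rewrite (_ : 2 ^+ h = \sum_(T : {set 'I_h}) 1); last first.
  by rewrite sumr_const -cardsT -powersetT card_powerset cardsT card_ord natrX.
rewrite mulr_suml -sumEFin; apply: lee_sum => T _; rewrite mul1r.
case: (boolP (h <= #|T|.*2)%N) => hT; last first.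
  by under eq_total do rewrite mulr0; rewrite /total esum1// lee_fin expR_ge0.
rewrite (total_iid_avoid p_ge0 p_total n (uS T)) lee_fin.
have Sq : #|T|%:R * q <= \sum_(a <- S T) p a.
  rewrite big_map big_enum/= mulr_natl -sumr_const; apply: ler_sum => i _.
  exact: pq.
have S1 : \sum_(a <- S T) p a <= 1.
  by rewrite -lee_fin -p_total sum_le_total.
have e1 : 1 - \sum_(a <- S T) p a <= expR (- (q * h%:R / 2)).
  apply: (le_trans _ (expR_ge1Dx _)); rewrite lerD2l lerN2.
  apply: (le_trans _ Sq); rewrite (_ : q * _ / 2 = h%:R / 2 * q); last by ring.
  by rewrite ler_wpM2r// ler_pdivrMr// -natrM ler_nat muln2.
apply: (le_trans (lerXn2r n _ _ e1)); rewrite ?nnegrE ?subr_ge0 ?expR_ge0//.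
rewrite -expRM_natl le_eqVlt; apply/orP; left; apply/eqP; congr expR; ring.
Qed.

(** Expectation of the pointwise bound.  The number of distinct symbols is at
    most [m] plus the number of symbols above [m]; if the cutoff is below [b],
    the symbols at most [b] are charged the Elias length of [b], and that event
    is controlled by [few_symbols]. *)
Lemma kl_ac_coding_le n m b h (q tm tb : R) :
  (0 < b)%N -> b%:R <= mu * h%:R / 2 -> 0 <= q ->
  (forall i, (i < h)%N -> q <= p (npos_succ (h + i))) ->
  total (fun a : npos => p a * (m < val a)%N%:R) = tm%:E ->
  total (fun a : npos => p a * ((b < val a)%N%:R * (elias (val a))%:R)) = tb%:E ->
  (0 < n)%N -> forall M, M = log2 ((3 + mu) * n%:R) ->
  (kl (@iid R _ p n) Q <=
   (2 + 5 * M + 2 * M * (2 + mu * m%:R) + 2 * M * mu * (n%:R * tm) + n%:R * tb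
    + n%:R * (elias b)%:R * (2 ^+ h * expR (- (n%:R * q * h%:R / 2))))%:E)%E.
Proof.
move=> b0 bh q0 pq tmE tbE n0 M ME.
have nR : (1 : R) <= n%:R by rewrite ler1n.
have m3 : 1 <= 3 + mu by have := mu_gt0; lra.
have M0 : 0 <= M by rewrite ME log2_ge0// mulr_ege1.
pose Fm (x : n.-tuple npos) : R := \sum_(i < n) (m < val (tnth x i))%N%:R.
pose Fb (x : n.-tuple npos) : R :=
  \sum_(i < n) (b < val (tnth x i))%N%:R * (elias (val (tnth x i)))%:R.
pose A := 2 + 5 * M + 2 * M * (2 + mu * m%:R).
pose B := 2 * M * mu.
pose C : R := n%:R * (elias b)%:R.
have A0 : 0 <= A by rewrite !addr_ge0 ?mulr_ge0 ?addr_ge0 ?mulr_ge0// ltW.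
have B0 : 0 <= B by rewrite /B mulr_ge0 ?mulr_ge0// ltW.
have C0 : 0 <= C by rewrite mulr_ge0.
have Fm0 x : 0 <= Fm x by rewrite sumr_ge0.
have Fb0 x : 0 <= Fb x by rewrite sumr_ge0// => i _; rewrite mulr_ge0.
have S0 x : 0 <= few_symbols h x :> R by rewrite sumr_ge0.
have i0 (x : n.-tuple npos) : 0 <= iid p x by exact: iid_ge0.
pose u (x : n.-tuple npos) := A * iid p x + B * (iid p x * Fm x) +
   iid p x * Fb x + C * (iid p x * few_symbols h x).
have uE : (total u <= (A + B * (n%:R * tm) + n%:R * tb +
    C * (2 ^+ h * expR (- (n%:R * q * h%:R / 2))))%:E)%E.
  have t1 (x : n.-tuple npos) : 0 <= A * iid p x by rewrite mulr_ge0.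
  have t2 (x : n.-tuple npos) : 0 <= B * (iid p x * Fm x) by rewrite mulr_ge0// mulr_ge0.
  have t3 (x : n.-tuple npos) : 0 <= iid p x * Fb x by rewrite mulr_ge0// mulr_ge0.
  have t4 (x : n.-tuple npos) : 0 <= C * (iid p x * few_symbols h x) by rewrite mulr_ge0// mulr_ge0.
  have t12 (x : n.-tuple npos) : 0 <= A * iid p x + B * (iid p x * Fm x) by rewrite addr_ge0.
  have t123 (x : n.-tuple npos) : 0 <= A * iid p x + B * (iid p x * Fm x) + iid p x * Fb x.
    by rewrite addr_ge0.
  rewrite /u (totalD t123 t4) (totalD t12 t3) (totalD t1 t2).
  rewrite !totalZ// total_iid// mule1.
  rewrite (total_iid_sum p_ge0 p_total n _ tmE)//.
  rewrite (total_iid_sum p_ge0 p_total n _ tbE); last by move=> a; rewrite mulr_ge0.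
  rewrite !EFinD !EFinM leeD2l// lee_wpmul2l ?lee_fin// -EFinM.
  exact: total_few_symbols.
apply: (le_trans _ uE); apply: kl_le => x.
  by rewrite /u !addr_ge0// mulr_ge0// mulr_ge0.
have H := kl_term_ac_le (x := x) erefl.
apply: (le_trans H); rewrite lee_fin.
set K := cutoff mu x; set Z := size (undup x).
rewrite (_ : u x = iid p x * (A + B * Fm x + Fb x + C * few_symbols h x)); last by rewrite /u; ring.
rewrite ler_wpM2l//.
have FmE : Fm x = (count (fun a : npos => (m < val a)%N) x)%:R.
  rewrite /Fm -(big_tuple _ _ x xpredT (fun a : npos => (m < val a)%N%:R)).
  by rewrite -natr_sum -sum1_count [in RHS]big_mkcond.
have FbE : Fb x = (\sum_(a <- x) (b < val a)%N * elias (val a))%N%:R.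
  rewrite /Fb natr_sum big_tuple; apply: eq_bigr => i _; exact: esym (natrM _ _ _).
have ZF : Z%:R <= m%:R + Fm x.
  rewrite FmE -natrD ler_nat /Z -(count_predC (fun a : npos => (val a <= m)%N)).
  apply: leq_add.
    rewrite -size_filter -[X in (_ <= X)%N](size_iota 0 m) -(size_map npos_succ).
    apply: uniq_leq_size; first by rewrite filter_uniq ?undup_uniq.
    move=> a; rewrite mem_filter => /andP[am _]; apply/mapP; exists (val a).-1.
      by rewrite mem_iota/= add0n prednK// (valP a).
    by rewrite npos_succK.
  rewrite (eq_count (a2 := fun a : npos => (m < val a)%N)); last first.
    by move=> a /=; rewrite ltnNge.
  exact/leq_count_subseq/undup_subseq.
have Z0 : 0 <= mu * Z%:R by rewrite mulr_ge0// ltW.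
have Kmu : K%:R <= 1 + mu * Z%:R.
  apply: (@le_trans _ _ (1 + Num.truncn (mu * Z%:R))%N%:R).
    by rewrite ler_nat /K /cutoff -/Z geq_max leq_addr leq_addl.
  by rewrite natrD lerD2l truncn_le.
have Zn : Z%:R <= n%:R :> R by rewrite ler_nat -[n in leqRHS](size_tuple x) size_undup.
have KM : (n + K.+1)%:R <= (3 + mu) * n%:R.
  have : mu * Z%:R <= mu * n%:R by rewrite ler_pM2l.
  rewrite natrD -natr1 mulrDl; lra.
have lM : log2 (n + K.+1)%:R <= M by rewrite ME le_log2// ltr0n addnS.
have eK : (elias K)%:R <= 1 + 5 * M.
  apply: (le_trans (elias_length_le R K)); rewrite lerD2l ler_pM2l//.
  apply: le_trans lM; apply: le_log2; first by rewrite ltr0n cutoff_gt0.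
  by rewrite ler_nat addnS leqW// leq_addl.
have KK : 2 * K.+1%:R * log2 (n + K.+1)%:R <= 2 * M * (2 + mu * m%:R) + B * Fm x.
  apply: (@le_trans _ _ (2 * K.+1%:R * M)); first by rewrite ler_wpM2l// mulr_ge0.
  have : mu * Z%:R <= mu * (m%:R + Fm x) by rewrite ler_pM2l.
  rewrite -natr1 /B => h1.
  rewrite (_ : _ + _ = 2 * (2 + mu * (m%:R + Fm x)) * M); last by ring.
  by rewrite ler_wpM2r//; lra.
have SS : (\sum_(a <- x | (K < val a)%N) elias (val a))%N%:R <= Fb x + C * few_symbols h x.
  rewrite FbE /C; have [bK|Kb] := leqP b K.
    apply: ler_wpDr; first by rewrite !mulr_ge0.
    rewrite ler_nat big_mkcond; apply: leq_sum => a _.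
    by case: ltnP => // Ka; rewrite (leq_ltn_trans bK Ka) mul1n.
  (* the cutoff is below b <= mu h / 2, so fewer than h / 2 symbols occur *)
  have few : 1 <= few_symbols h x.
    apply: few_symbols_ge1; rewrite -/Z.
    have Zb : mu * Z%:R < b%:R.
      rewrite ltNge; apply/negP; rewrite -truncn_ge_nat// => bZ.
      by move: Kb; rewrite /K /cutoff -/Z gtn_max => /andP[_]; rewrite ltnNge bZ.
    have : mu * Z%:R < mu * (h%:R / 2) by rewrite mulrA (lt_le_trans Zb).
    rewrite ltr_pM2l// ltr_pdivlMr// -natrM ltr_nat muln2; exact: ltnW.
  apply: (@le_trans _ _ ((\sum_(a <- x) (b < val a)%N * elias (val a))%N%:R + n%:R * (elias b)%:R)).
    rewrite -natrM -natrD ler_nat -[in (n * _)%N](size_tuple x) -sum1_size big_distrl/=.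
    rewrite -big_split/= big_mkcond; apply: leq_sum => a _; rewrite mul1n.
    case: (K < val a)%N => //; case: (leqP (val a) b) => ab.
      by rewrite mul0n add0n elias_length_homo ?(valP a).
    by rewrite mul1n leq_addr.
  by rewrite lerD2l ler_peMr.
rewrite /A; lra.
Qed.

End CodeLength.

(** * Growth of the minimax redundancy and tails of the source *)

Section Growth.
Variables (R : realType) (alpha : R) (P : source R).
Hypothesis PW : power_class alpha P.
Local Notation p := (marginal P).
Local Notation elias := (elias_length R).

(** A symbol of this size has probability of order [1/n], so this is roughly how
    many distinct symbols a sample of size [n] contains. *)
Definition growth (n : nat) : R := n%:R `^ alpha^-1.

Let alpha1 : 1 < alpha. Proof. exact: power_class_exponent PW. Qed.
Let alpha0 : 0 < alpha. Proof. by rewrite (lt_trans ltr01). Qed.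

Lemma growth_ge1 n : (0 < n)%N -> 1 <= growth n.
Proof.
move=> n0; have <- : (1 : R) `^ alpha^-1 = 1 by rewrite powR1.
by rewrite ge0_ler_powR ?nnegrE ?invr_ge0 ?ler1n// ltW.
Qed.

Lemma growth_le n : (0 < n)%N -> growth n <= n%:R.
Proof.
move=> n0; rewrite -[leRHS]powRr1// ler_powR ?ler1n//.
by rewrite invf_le1// ltW.
Qed.

Lemma growthK n : growth n `^ alpha = n%:R.
Proof. by rewrite -powRrM mulVf ?powRr1// gt_eqF. Qed.

Lemma growth_scale n (x : R) : (0 < n)%N -> 0 < x ->
  n%:R * (x * growth n) `^ (- alpha) = x `^ (- alpha).
Proof.
move=> n0 x0; have nR : (0 : R) < n%:R by rewrite ltr0n.
rewrite powRM ?powR_ge0 ?(ltW x0)// mulrCA (powRN (growth n)) growthK.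
by rewrite divff ?mulr1// gt_eqF.
Qed.

Lemma growth_scale_tail n (x : R) : (0 < n)%N -> 0 < x ->
  n%:R * (x * growth n) `^ (- (alpha - 1)) = x `^ (- (alpha - 1)) * growth n.
Proof.
move=> n0 x0; have y0 : 0 < growth n by rewrite powR_gt0// ltr0n.
rewrite powRM ?(ltW x0) ?(ltW y0)// mulrCA; congr (_ * _).
rewrite -[in LHS](growthK n) -powRD; last by rewrite (gt_eqF y0) implybT.
by rewrite opprB addrC subrK powRr1// ltW.
Qed.

Lemma growth_dvg (B : R) : exists n0, forall n, (n0 <= n)%N -> B <= growth n.
Proof.
exists (Num.truncn (`|B| `^ alpha)).+1 => n Bn.
apply: (le_trans (ler_norm B)).
rewrite -[leLHS]powRr1// -(divff (lt0r_neq0 alpha0)) powRrM.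
rewrite ge0_ler_powR ?nnegrE ?powR_ge0 ?invr_ge0 ?(ltW alpha0)//.
by rewrite ltW// (lt_le_trans (truncnS_gt _))// ler_nat.
Qed.

Lemma marginal_lower : exists2 c, 0 < c <= 1 & exists k0, forall k, (k0 <= k)%N ->
  c * k.+1%:R `^ (- alpha) <= p (npos_succ k).
Proof.
have [c c0 [k0 H]] := power_class_lower PW.
exists (Num.min c 1); first by rewrite lt_min c0 ltr01 ge_min lexx orbT.
exists k0 => k /H; apply: le_trans; rewrite ler_wpM2r ?powR_ge0//.
by rewrite ge_min lexx.
Qed.

(** With [m] between [y] and [2y], the odd members of the pairs are at most
    [8y], so each has probability at least [c (8y)^(-alpha) = c 8^(-alpha) / n]. *)
Lemma minimax_growth : exists2 kappa, 0 < kappa & exists n0, forall n, (n0 <= n)%N ->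
  ((kappa * growth n)%:E <= minimax_redundancy (power_class alpha) n)%E.
Proof.
have [c /andP[c0 c1] [k0 H]] := marginal_lower.
pose c' := c * 8 `^ (- alpha); have c'0 : 0 < c' by rewrite mulr_gt0// powR_gt0.
exists (1 - expR (- c')); first by rewrite subr_gt0 -expR0 ltr_expR oppr_lt0.
have [n1 Hn1] := growth_dvg k0%:R.
exists (maxn 1 n1) => n; rewrite geq_max => /andP[n0 /Hn1 yk0].
have y1 := growth_ge1 n0; set y := growth n in y1 yk0 *.
pose m := (Num.truncn y).+1.
have ym : y < m%:R by exact: truncnS_gt.
have m2y : m%:R <= 2 * y.
  rewrite /m -natr1; have : (Num.truncn y)%:R <= y by rewrite truncn_le// (le_trans ler01).
  lra.
apply: (le_trans _ (minimax_redundancy_ge PW n (ltn0Sn _ : (0 < m)%N))).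
rewrite lee_fin /expected_seen.
apply: (@le_trans _ _ (\sum_(i < m) (1 - expR (- c')))); last first.
  apply: ler_sum => i _; rewrite lerD2l lerN2.
  set a := pair_symbol i true; have va : val a = ((m + i).*2 + 1)%N by rewrite val_pair_symbol.
  have pa : c * (val a)%:R `^ (- alpha) <= p a.
    rewrite -{2}(npos_succK a) -[val a in leLHS]prednK ?(valP a)//; apply: H.
    have : (k0 < m)%N by rewrite -(ltr_nat R) (le_lt_trans yk0).
    by rewrite va addn1/= -addnn; lia.
  have p1 : p a <= 1 by exact: law_le1.
  have nq : c' <= n%:R * p a.
    apply: (@le_trans _ _ (n%:R * (c * (8 * y) `^ (- alpha)))).
      by rewrite mulrCA growth_scale.
    rewrite ler_wpM2l// (le_trans _ pa)// ler_wpM2l ?(ltW c0)//.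
    rewrite !powRN lef_pV2 ?posrE ?powR_gt0 ?ltr0n ?(valP a) ?mulr_gt0 ?(lt_le_trans ltr01 y1)//.
    rewrite ge0_ler_powR ?nnegrE ?(ltW alpha0)//; first by rewrite mulr_ge0// (le_trans ler01).
    apply: (@le_trans _ _ (4 * m%:R)); last by lra.
    rewrite -natrM ler_nat va; have := ltn_ord i; lia.
  apply: (@le_trans _ _ (expR (- (n%:R * p a)))); last by rewrite ler_expR lerN2.
  rewrite -mulrN expRM_natl lerXn2r ?nnegrE ?subr_ge0 ?expR_ge0//.
  exact: expR_ge1Dx.
rewrite sumr_const card_ord -[leRHS]mulr_natr ler_wpM2l//; last exact: ltW.
by rewrite subr_ge0 -expR0 ler_expR oppr_le0 ltW.
Qed.

Lemma marginal_tail m : (0 < m)%N ->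
  (total (fun a : npos => p a * (m < val a)%N%:R)%R <=
    (m%:R `^ (- (alpha - 1)) / (alpha - 1))%:E)%E.
Proof.
move=> m0; have g0 : 0 < alpha - 1 by rewrite subr_gt0.
apply: (le_trans _ (powR_tail_le g0 m0)); apply: le_total => a.
by rewrite mulrC ler_wpM2l// [X in - X]addrC subrK power_class_upper.
Qed.

(** [log a = log b + log (a/b)], and [log (a/b)] is absorbed by [(a/b)^h] with
    [h] half of the margin [alpha - 1]; a crude bound on [log a] would cost an
    additional power of [b]. *)
Lemma elias_tail b : (0 < b)%N ->
  (total (fun a : npos => p a * ((b < val a)%N%:R * (elias (val a))%:R))%R <=
    (b%:R `^ (- (alpha - 1)) * ((1 + 5 * log2 (b%:R : R)) / (alpha - 1)
       + 5 / (((alpha - 1) / 2) ^+ 2 * ln 2)))%:E)%E.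
Proof.
move=> b0; set g := alpha - 1; set h := g / 2; have l2 := @ln2_gt0 R.
have g0 : 0 < g by rewrite subr_gt0.
have h0 : 0 < h by rewrite divr_gt0.
have bR : (0 : R) < b%:R by rewrite ltr0n.
set lb := log2 (b%:R : R); have lb0 : 0 <= lb by exact: log2_nat_ge0.
pose C := 5 / (h * ln 2) * b%:R `^ (- h).
have C0 : 0 <= C by rewrite mulr_ge0 ?powR_ge0// divr_ge0// mulr_ge0// ltW.
have D0 : 0 <= 1 + 5 * lb by rewrite addr_ge0// mulr_ge0.
apply: (@le_trans _ _ (total (fun a : npos =>
    (1 + 5 * lb) * ((b < val a)%N%:R * (val a)%:R `^ (- (1 + g))) +
    C * ((b < val a)%N%:R * (val a)%:R `^ (- (1 + h))))%R)).
  apply: le_total => a; have aR : (0 : R) < (val a)%:R by rewrite ltr0n (valP a).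
  case: ltnP => ba; last by rewrite !mul0r !mulr0 addr0.
  rewrite !mul1r.
  have pa : p a <= (val a)%:R `^ (- (1 + g)).
    by rewrite [X in - X]addrC subrK power_class_upper.
  apply: (le_trans (ler_wpM2r _ pa)) => //.
  rewrite [leRHS](_ : _ = (val a)%:R `^ (- (1 + g)) * (1 + 5 * lb + C * (val a)%:R `^ h)); last first.
    rewrite mulrDr (mulrC (1 + 5 * lb)); congr (_ + _).
    rewrite mulrCA -powRD; last by rewrite (gt_eqF aR) implybT.
    by congr (C * _ `^ _); rewrite /h; field.
  rewrite ler_wpM2l ?powR_ge0//; apply: (le_trans (elias_length_le R _)).
  rewrite -addrA lerD2l.
  have -> : log2 ((val a)%:R : R) = lb + log2 ((val a)%:R / b%:R).
    by rewrite -log2M ?divr_gt0// mulrCA divff ?mulr1// gt_eqF.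
  rewrite mulrDr lerD2l /C.
  have bV : b%:R^-1 `^ h = b%:R `^ (- h) :> R.
    by rewrite -powR_inv1 ?(ltW bR)// -powRrM mulN1r.
  have H := ln_le_powR h0 (divr_gt0 aR bR).
  rewrite powRM ?invr_ge0 ?(ltW aR) ?(ltW bR)// bV in H.
  rewrite [leRHS](_ : _ = 5 * (((val a)%:R `^ h * b%:R `^ (- h) / h) / ln 2)).
    by rewrite ler_wpM2l// ler_wpM2r// invr_ge0 ltW.
  by field; rewrite !gt_eqF.
rewrite totalD => [|a|a]; last 2 first.
- by rewrite mulr_ge0// mulr_ge0 ?powR_ge0.
- by rewrite mulr_ge0// mulr_ge0 ?powR_ge0.
rewrite !totalZ//.
apply: (@le_trans _ _ ((1 + 5 * lb)%:E * (b%:R `^ (- g) / g)%:E + C%:E * (b%:R `^ (- h) / h)%:E)%E).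
  by apply: leeD; apply: lee_wpmul2l; rewrite ?lee_fin ?powR_tail_le.
rewrite -!EFinM -EFinD lee_fin le_eqVlt; apply/orP; left; apply/eqP.
rewrite /C (_ : b%:R `^ (- g) = b%:R `^ (- h) * b%:R `^ (- h)); last first.
  rewrite -powRD; last by rewrite (gt_eqF bR) implybT.
  by congr (_ `^ _); rewrite /h; field.
by field; rewrite !gt_eqF.
Qed.

End Growth.

(** * Growth of the redundancy of the code *)

Section KLGrowth.
Variables (R : realType) (arith : nat -> seq nat -> nat) (mu : R).
Hypotheses (arithP : kt_arithmetic_length R arith) (mu_gt0 : 0 < mu).
Variables (alpha : R) (P : source R).
Hypothesis PW : power_class alpha P.
Local Notation p := (marginal P).
Local Notation elias := (elias_length R).
Local Notation growth := (growth alpha).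

(** [(u y)^alpha <= expR (alpha u y)] for [u = d / alpha], and [y^alpha = n]. *)
Lemma growth_exp_bound (d : R) n : 0 < d -> (0 < n)%N ->
  n%:R * expR (- (d * growth n)) <= (d / alpha) `^ (- alpha).
Proof.
move=> d0 n0; have a1 := power_class_exponent PW.
have a0 : 0 < alpha by rewrite (lt_trans ltr01).
have y0 : 0 < growth n by rewrite powR_gt0// ltr0n.
have u0 : 0 < d / alpha by rewrite divr_gt0.
rewrite powRN expRN ler_pdivrMr ?expR_gt0// ler_pdivlMl ?powR_gt0//.
rewrite -(growthK PW n) -powRM ?(ltW y0) ?(ltW u0)//.
have -> : expR (d * growth n) = expR (growth n * (d / alpha)) `^ alpha.
  by rewrite /powR gt_eqF ?expR_gt0// expRK; congr expR; field; rewrite gt_eqF.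
rewrite ge0_ler_powR ?nnegrE ?expR_ge0 ?(ltW a0)//.
  by rewrite mulr_ge0// ltW.
by have := expR_ge1Dx (growth n * (d / alpha)); rewrite [_ * growth n]mulrC; lra.
Qed.

Lemma two_pow_exp h (t : R) : 4 <= t -> 2 ^+ h * expR (- (t * h%:R / 2)) <= expR (- h%:R).
Proof.
move=> t4; have e2 : 2 <= expR 1 :> R.
  by apply: (le_trans _ (expR_ge1Dx 1)); lra.
apply: (@le_trans _ _ (expR h%:R * expR (- (2 * h%:R)))).
  apply: ler_pM; rewrite ?exprn_ge0 ?expR_ge0//.
    by rewrite -[h%:R]mulr1 expRM_natl lerXn2r ?nnegrE ?expR_ge0.
  rewrite ler_expR lerN2 mulrAC ler_wpM2r//; lra.
by rewrite -expRD ler_expR; lra.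
Qed.

Lemma truncn_ge_half (x : R) : 1 <= x -> x / 2 <= (Num.truncn x)%:R.
Proof.
move=> x1; have : x < (Num.truncn x).+1%:R by exact: truncnS_gt.
have : (1 : R) <= (Num.truncn x)%:R by rewrite ler1n truncn_gt0.
by rewrite -natr1; lra.
Qed.

(** Each of the six contributions to the redundancy is a multiple of [y * M]. *)
Lemma redundancy_budget (y M m g W e C3 ntm ntb nlast : R) :
  1 <= y -> 1 <= M -> m <= 2 * y -> 0 < g -> 0 <= W -> 0 <= e -> 0 <= C3 ->
  ntm <= y / g -> ntb <= W * y * ((1 + 5 * M) / g + e) -> nlast <= (1 + 5 * M) * C3 ->
  2 + 5 * M + 2 * M * (2 + mu * m) + 2 * M * mu * ntm + ntb + nlast <=
  (11 + 4 * mu + 2 * mu / g + W * (6 / g + e) + 6 * C3) * (y * M).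
Proof.
move=> y1 M1 m2y g0 W0 e0 C30 hm hb hl; have mu0 := mu_gt0.
have y0 : 0 <= y by rewrite (le_trans ler01).
have M0 : 0 <= M by rewrite (le_trans ler01).
have yMM : M <= y * M by rewrite ler_peMl.
have yM1 : 1 <= y * M by rewrite (le_trans M1).
have t1 : 2 * M * (2 + mu * m) <= (4 + 4 * mu) * (y * M).
  apply: (@le_trans _ _ (2 * M * (2 + mu * (2 * y)))).
    by rewrite ler_wpM2l ?mulr_ge0// lerD2l ler_pM2l.
  rewrite (_ : 2 * M * _ = 4 * M + 4 * mu * (y * M)); last by ring.
  by rewrite [leRHS]mulrDl lerD2r ler_pM2l.
have t2 : 2 * M * mu * ntm <= 2 * mu / g * (y * M).
  rewrite [leRHS](_ : _ = 2 * M * mu * (y / g)); last by field; rewrite gt_eqF.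
  by rewrite ler_wpM2l// mulr_ge0 ?mulr_ge0// ltW.
have t3 : ntb <= W * (6 / g + e) * (y * M).
  apply: (le_trans hb).
  rewrite [leRHS](_ : _ = W * y * ((6 / g + e) * M)); last by ring.
  rewrite ler_wpM2l ?mulr_ge0// [leRHS]mulrDl; apply: lerD.
    by rewrite [leRHS]mulrAC ler_pM2r ?invr_gt0//; lra.
  by rewrite ler_peMr.
have t4 : (1 + 5 * M) * C3 <= 6 * C3 * (y * M).
  rewrite [leRHS](_ : _ = 6 * (y * M) * C3); last by ring.
  by rewrite ler_wpM2r//; lra.
rewrite [leRHS](_ : _ = 2 * (y * M) + 5 * (y * M) + (4 + 4 * mu) * (y * M)
   + 2 * mu / g * (y * M) + W * (6 / g + e) * (y * M) + 6 * C3 * (y * M)); last by ring.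
apply: lerD; last exact: le_trans hl t4.
by do 3![apply: lerD => //]; apply: lerD; lra.
Qed.

(** The scales are [h = delta y] for the union bound, [b = mu h / 2] for the
    least typical cutoff, and [m] between [y] and [2y] for the number of distinct
    symbols. *)
Lemma kl_growth : exists2 C, 0 <= C & exists n0, forall n, (n0 <= n)%N ->
  (kl (@iid R _ p n) (fun x => ac_coding_prob arith mu x) <=
     (C * (growth n * log2 n%:R))%:E)%E.
Proof.
have a1 := power_class_exponent PW.
have a0 : 0 < alpha by rewrite (lt_trans ltr01).
set g := alpha - 1; have g0 : 0 < g by rewrite subr_gt0.
have l2 := @ln2_gt0 R.
have [c /andP[c0 c1] [k0 pk]] := marginal_lower PW.
(* delta makes n times the probability of each symbol up to 2h at least 4,
   so that the exponent n q h / 2 in the union bound beats 2^h *)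
pose delta := (c / 4) `^ alpha^-1 / 2.
have d0 : 0 < delta by rewrite divr_gt0// powR_gt0// divr_gt0.
have dc : c * (2 * delta) `^ (- alpha) = 4.
  rewrite /delta [2 * _]mulrC divfK// powRN -powRrM mulVf ?gt_eqF// powRr1 ?divr_ge0 ?(ltW c0)//.
  by field; rewrite gt_eqF.
have d1 : delta <= 1.
  suff : (c / 4) `^ alpha^-1 <= 1 by rewrite /delta; lra.
  apply: (@le_trans _ _ (1 `^ alpha^-1)); last by rewrite powR1.
  rewrite ge0_ler_powR ?nnegrE ?invr_ge0 ?(ltW a0) ?divr_ge0 ?(ltW c0)//; lra.
clearbody delta.
pose eps := mu * delta / 8; have eps0 : 0 < eps by rewrite divr_gt0// mulr_gt0.
pose e5 := 5 / ((g / 2) ^+ 2 * ln 2).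
have e50 : 0 <= e5 by rewrite divr_ge0// mulr_ge0 ?exprn_ge0// ?divr_ge0// ltW.
pose C3 := (delta / 2 / alpha) `^ (- alpha).
have C30 : 0 <= C3 by exact: powR_ge0.
pose W := eps `^ (- g); have W0 : 0 <= W by exact: powR_ge0.
pose C2 := 11 + 4 * mu + 2 * mu / g + W * (6 / g + e5) + 6 * C3.
have C20 : 0 <= C2.
  have h1 : 0 <= 2 * mu / g by rewrite divr_ge0 ?mulr_ge0// ltW.
  have h2 : 0 <= W * (6 / g + e5) by rewrite mulr_ge0// addr_ge0// divr_ge0// ltW.
  by rewrite /C2; have := mu_gt0; lra.
have m3 : 1 <= 3 + mu by have := mu_gt0; lra.
pose lm := log2 (3 + mu); have lm0 : 0 <= lm by rewrite log2_ge0.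
exists (C2 * (1 + lm)); first by rewrite mulr_ge0// addr_ge0.
have [n1 Hn1] := growth_dvg PW (k0.+1%:R / delta + 4 / (mu * delta)).
exists (maxn 2 n1) => n; rewrite geq_max => /andP[n2 /Hn1 yB].
have n0 : (0 < n)%N by exact: ltnW.
have nR : (0 : R) < n%:R by rewrite ltr0n.
have y1 := growth_ge1 PW n0; have yn := growth_le PW n0.
have y0 : 0 < growth n by rewrite (lt_le_trans ltr01).
have dy : k0.+1%:R + 4 / mu <= delta * growth n.
  rewrite -(ler_pM2l d0) in yB; apply: le_trans yB.
  by rewrite le_eqVlt; apply/orP; left; apply/eqP; field; rewrite !gt_eqF.
have m4 : 0 < 4 / mu by rewrite divr_gt0.
have k1 : (1 : R) <= k0.+1%:R by rewrite ler1n.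
have dy0 : 0 <= delta * growth n by lra.
pose h := Num.truncn (delta * growth n).
have hy : h%:R <= delta * growth n by rewrite truncn_le.
have hy2 : delta * growth n / 2 <= h%:R by apply: truncn_ge_half; lra.
have hk : (k0 < h)%N by rewrite truncn_ge_nat//; lra.
have h0 : (0 : R) < h%:R by rewrite ltr0n (leq_ltn_trans _ hk).
have muh : 1 <= mu * h%:R / 2.
  rewrite ler_pdivlMr// mul1r -ler_pdivrMl//; apply: (le_trans _ hy2); lra.
pose b := Num.truncn (mu * h%:R / 2).
have bmu : b%:R <= mu * h%:R / 2 by rewrite truncn_le// (le_trans ler01).
have b0 : (0 < b)%N by rewrite truncn_gt0.
have be : eps * growth n <= b%:R.
  apply: (le_trans _ (truncn_ge_half muh)).
  rewrite (_ : eps * _ = mu * (delta * growth n / 2) / 4); last by rewrite /eps; field.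
  rewrite (_ : mu * h%:R / 2 / 2 = mu * h%:R / 4); last by field.
  by rewrite ler_pM2r// ler_pM2l.
pose m := (Num.truncn (growth n)).+1.
have ym : growth n <= m%:R by apply: ltW; exact: truncnS_gt.
have m2y : m%:R <= 2 * growth n.
  rewrite /m -natr1.
  have : (Num.truncn (growth n))%:R <= growth n by rewrite truncn_le// ltW.
  lra.
pose q := c * (2 * h%:R) `^ (- alpha).
have q0 : 0 <= q by rewrite mulr_ge0 ?powR_ge0// ltW.
have pq i : (i < h)%N -> q <= p (npos_succ (h + i)).
  move=> ih; apply: (le_trans _ (pk _ _)); last by rewrite (leq_trans (ltnW hk))// leq_addr.
  rewrite ler_wpM2l ?(ltW c0)// !powRN lef_pV2 ?posrE ?powR_gt0 ?mulr_gt0//.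
  rewrite ge0_ler_powR ?nnegrE ?(ltW a0) ?mulr_ge0//.
  by rewrite -natrM ler_nat mul2n -addnn ltn_add2l.
have nq : 4 <= n%:R * q.
  have d20 : 0 < 2 * delta by rewrite mulr_gt0.
  rewrite -[leLHS]dc -(growth_scale PW n0 d20) mulrCA.
  rewrite ler_wpM2l ?(ltW nR)// ler_wpM2l ?(ltW c0)//.
  rewrite !powRN lef_pV2 ?posrE ?powR_gt0 ?mulr_gt0//.
  rewrite ge0_ler_powR ?nnegrE ?(ltW a0)// ?mulr_ge0 ?(ltW d0) ?(ltW y0)//.
  by rewrite -mulrA ler_pM2l.
have p0 a : 0 <= p a by exact: law_ge0.
have [|tm tmE /andP[tm0 tmle]] := total_le_fin _ (marginal_tail PW (ltn0Sn _ : (0 < m)%N)).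
  by move=> a; rewrite mulr_ge0.
have [|tb tbE /andP[tb0 tble]] := total_le_fin _ (elias_tail PW b0).
  by move=> a; rewrite !mulr_ge0.
pose M := log2 ((3 + mu) * n%:R).
have M1 : 1 <= M.
  rewrite /M -[leLHS](@log2_2 R) le_log2//.
  have n2R : (2 : R) <= n%:R by rewrite (ler_nat _ 2).
  by rewrite -[leLHS]mul1r ler_pM.
have lbM : log2 (b%:R : R) <= M.
  apply: le_log2; first by rewrite ltr0n.
  apply: (le_trans bmu).
  have hn : h%:R <= n%:R :> R.
    by apply: (le_trans hy); apply: (le_trans _ yn); rewrite ler_piMl// ltW.
  have : mu * h%:R <= mu * n%:R by rewrite ler_pM2l.
  have : 0 <= mu * h%:R by rewrite mulr_ge0// ltW.
  by rewrite mulrDl; lra.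
apply: (le_trans (kl_ac_coding_le arithP mu_gt0 p0 (total_marginal P) b0 bmu q0 pq tmE tbE n0 (erefl M))).
rewrite lee_fin.
have ntm : n%:R * tm <= growth n / g.
  apply: (@le_trans _ _ (n%:R * ((1 * growth n) `^ (- g) / g))).
    rewrite ler_wpM2l// (le_trans tmle)// ler_pM2r ?invr_gt0// mul1r.
    by rewrite !powRN lef_pV2 ?posrE ?powR_gt0// ge0_ler_powR ?nnegrE ?(ltW g0) ?(ltW y0).
  by rewrite mulrA (growth_scale_tail PW)// powR1 mul1r.
have ntb : n%:R * tb <= W * growth n * ((1 + 5 * M) / g + e5).
  apply: (@le_trans _ _ (n%:R * ((eps * growth n) `^ (- g) * ((1 + 5 * M) / g + e5)))).
    rewrite ler_wpM2l// (le_trans tble)//; apply: ler_pM.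
    - exact: powR_ge0.
    - rewrite addr_ge0// divr_ge0 ?(ltW g0)// addr_ge0// mulr_ge0//.
      exact: log2_nat_ge0.
    - rewrite !powRN lef_pV2 ?posrE ?powR_gt0 ?mulr_gt0 ?ltr0n//.
      by rewrite ge0_ler_powR ?nnegrE ?(ltW g0)// mulr_ge0// ltW.
    - by rewrite lerD2r ler_pM2r ?invr_gt0// lerD2l ler_pM2l.
  by rewrite mulrA (growth_scale_tail PW).
have last : n%:R * (elias b)%:R * (2 ^+ h * expR (- (n%:R * q * h%:R / 2))) <= (1 + 5 * M) * C3.
  set X := 2 ^+ h * _; have X0 : 0 <= X by rewrite mulr_ge0 ?exprn_ge0 ?expR_ge0.
  rewrite (_ : _ * X = (elias b)%:R * (n%:R * X)); last by ring.
  apply: ler_pM; [by []|by rewrite mulr_ge0| |].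
    by apply: (le_trans (elias_length_le R b)); rewrite lerD2l ler_pM2l.
  apply: (@le_trans _ _ (n%:R * expR (- (delta / 2 * growth n)))); last first.
    by apply: growth_exp_bound => //; rewrite divr_gt0.
  rewrite ler_wpM2l// (le_trans (two_pow_exp _ nq))// ler_expR lerN2.
  by rewrite (_ : delta / 2 * _ = delta * growth n / 2)//; ring.
apply: (le_trans (redundancy_budget y1 M1 m2y g0 W0 e50 C30 ntm ntb last)).
rewrite -/C2 -[leRHS]mulrA ler_wpM2l// [leRHS]mulrCA ler_wpM2l ?(ltW y0)//.
rewrite /M log2M//; last by rewrite (lt_le_trans ltr01).
have L1 : 1 <= log2 (n%:R : R) by rewrite -[leLHS](@log2_2 R) le_log2// (ler_nat _ 2).
by rewrite -/lm [leRHS]mulrDl mul1r [leRHS]addrC lerD2r ler_peMr.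
Qed.

End KLGrowth.

(** * Approximate adaptivity *)

Theorem theorem10 (R : realType) (mu : R) (arith : nat -> seq nat -> nat)
    (mu_gt0 : 0 < mu) (arithP : kt_arithmetic_length R arith)
    (alpha : R) (alpha_gt0 : 0 < alpha) (P : source R)
    (PW : power_class alpha P) :
  let D := fun n : nat => kl (@law R P n) (@ac_coding_prob R arith mu n) in
  let Rplus := minimax_redundancy (power_class alpha) in
  (\forall n \near \oo, D n \is a fin_num /\ (0 < Rplus n < +oo)%E) /\
  (fun n : nat => fine (D n) / fine (Rplus n)) =O_\oo
    (fun n : nat => log2 (n%:R : R)).
Proof.
move=> D Rplus; have l2 := @ln2_gt0 R.
have [C C0 [n1 upper]] := kl_growth arithP mu_gt0 PW.
have [kappa k0 [n2 lower]] := minimax_growth PW.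
pose n3 := maxn 2 (maxn n1 n2).
have bounds n : (n3 <= n)%N -> [/\ ((- (4 / ln 2))%:E <= D n)%E,
    (D n <= (C * (growth alpha n * log2 n%:R))%:E)%E,
    ((kappa * growth alpha n)%:E <= Rplus n)%E & (Rplus n < +oo)%E].
  rewrite !geq_max => /and3P[_ nn1 nn2].
  have lawE : @law R P n = @iid R _ (marginal P) n.
    by apply/funext => x; rewrite law_memoryless//; case: PW => -[].
  split.
  - by rewrite /D lawE; apply: kl_ac_coding_ge => // a; exact: law_ge0.
  - by rewrite /D lawE; exact: upper.
  - exact: lower.
  - exact: minimax_redundancy_lty (power_class_exponent PW).
have y0 n : (n3 <= n)%N -> 1 <= growth alpha n.
  by rewrite geq_max => /andP[n0 _]; apply: (growth_ge1 PW); exact: ltnW.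
have fin n : (n3 <= n)%N -> D n \is a fin_num /\ (0 < Rplus n < +oo)%E.
  move=> nn; have [dl du rl ru] := bounds n nn; split.
    by rewrite fin_numE -ltNye -ltey (lt_le_trans (ltNyr _) dl) (le_lt_trans du (ltry _)).
  rewrite ru andbT (lt_le_trans _ rl)// lte_fin mulr_gt0//.
  exact: lt_le_trans (y0 n nn).
split; first by near=> n; apply: fin; near: n; exact: nbhs_infty_ge.
apply/eqO_exP; exists ((4 / ln 2 + C) / kappa).
  by rewrite divr_gt0// ltr_pwDl// divr_gt0.
near=> n; have nn : (n3 <= n)%N by near: n; exact: nbhs_infty_ge.
have [dl du rl ru] := bounds n nn; have [Df /andP[R0 _]] := fin n nn.
have y1 := y0 n nn.
have n2R : (2 : R) <= n%:R.
  by rewrite (ler_nat _ 2); move: nn; rewrite geq_max => /andP[].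
have L1 : 1 <= log2 (n%:R : R) by rewrite -[leLHS](@log2_2 R) le_log2.
rewrite (ger0_norm (le_trans ler01 L1)).
have Rf : Rplus n \is a fin_num by rewrite gt0_fin_numE.
have fR : kappa * growth alpha n <= fine (Rplus n) by rewrite -lee_fin fineK.
have kg0 : 0 < kappa * growth alpha n by rewrite mulr_gt0// (lt_le_trans ltr01).
have yL : 1 <= growth alpha n * log2 (n%:R : R) by rewrite mulr_ege1.
have fD : `|fine (D n)| <= (4 / ln 2 + C) * (growth alpha n * log2 n%:R).
  have dR : - (4 / ln 2) <= fine (D n) by rewrite -lee_fin fineK.
  have uR : fine (D n) <= C * (growth alpha n * log2 n%:R) by rewrite -lee_fin fineK.
  have l4 : 0 <= 4 / ln 2 :> R by rewrite divr_ge0// ltW.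
  rewrite mulrDl ler_norml; apply/andP; split.
    apply: le_trans dR; rewrite lerN2 ler_wpDr ?ler_peMr// mulr_ge0//.
    exact: le_trans yL.
  by apply: (le_trans uR); rewrite lerDr mulr_ge0// (le_trans _ yL).
have fR0 : 0 < fine (Rplus n) by exact: lt_le_trans fR.
rewrite normrM normfV (gtr0_norm fR0) ler_pdivrMr//; apply: (le_trans fD).
rewrite [leLHS](_ : _ = (4 / ln 2 + C) / kappa * log2 n%:R * (kappa * growth alpha n)); last first.
  by field; rewrite !gt_eqF.
rewrite ler_wpM2l// mulr_ge0 ?(le_trans ler01 L1)// divr_ge0 ?(ltW k0)// addr_ge0//.
by rewrite divr_ge0// ltW.
Unshelve. all: by end_near. Qed.
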